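(* Let $b\ge 2$ be an integer, $p\ge 1$ an integer, and $z\ge 0$ real. For every real $\alpha>0$ with $\alpha\neq 1$, \begin{align*} \sum_{n=1}^{b^{p}-1}s_{b}(n)\left(\frac{1}{(z+n)^{\alpha}}-\frac{1}{(z+n+1)^{\alpha}}\right) =&\sum_{l=0}^{p-1}\frac{1}{b^{\alpha l}}\left[\zeta\left(\alpha,1+\frac{z}{b^{l}}\right)-\zeta\left(\alpha,1+\frac{z+b^{p}}{b^{l}}\right)\right]\\ &-\sum_{l=1}^{p}\frac{b}{b^{\alpha l}}\left[\zeta\left(\alpha,1+\frac{z}{b^{l}}\right)-\zeta\left(\alpha,1+\frac{z+b^{p}}{b^{l}}\right)\right]. \end{align*} Moreover, for $\alpha=1$ and all $z\ge 0$, \begin{align*} \sum_{n=1}^{b^{p}-1}\frac{s_{b}(n)}{(z+n)(z+n+1)} =& \sum_{l=0}^{p-1}\frac{1}{b^{l}}\left[\psi\left(1+\frac{z+b^{p}}{b^{l}}\right)-\psi\left(1+\frac{z}{b^{l}}\right)\right]\\ &-\sum_{l=1}^{p}\frac{b}{b^{l}}\left[\psi\left(1+\frac{z+b^{p}}{b^{l}}\right)-\psi\left(1+\frac{z}{b^{l}}\right)\right]. \end{align*}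
   Context: $s_b(n)$ denotes the sum of the digits of the base-$b$ expansion of the nonnegative integer $n$. $\zeta(\alpha,a)=\sum_{n\ge0}(a+n)^{-\alpha}$ is the Hurwitz zeta function (analytically continued in $\alpha$ where the series diverges), and $\psi=\Gamma'/\Gamma$ is the digamma function. *)

(* Defs.v *)
(* Stdlib reals, with Coquelicot for series, integrals and complex numbers. *)
From Stdlib Require Import Reals List ClassicalEpsilon.
From Coquelicot Require Import Coquelicot.

Open Scope R_scope.

(* The i-th base-b digit of n is (n / b ^ i) mod b.  For b >= 2 one has
   n < b ^ (n + 1), so the digits of index i > n all vanish. *)
Definition digit_sum (b n : nat) : nat :=
  list_sum (map (fun i => ((n / b ^ i) mod b)%nat) (seq 0 (S n))).

Definition cexp (s : C) : C :=
  (exp (Re s) * cos (Im s), exp (Re s) * sin (Im s)).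

(* Principal power x ^ s; meaningful only for x > 0, since [ln x = 0]
   for x <= 0. *)
Definition cpower (x : R) (s : C) : C := cexp (s * RtoC (ln x))%C.

Definition analytic_at (f : C -> C) (s0 : C) : Prop :=
  exists (c : nat -> C) (r : R), 0 < r /\
    forall s : C, Cmod (s - s0)%C < r -> is_pseries c (s - s0)%C (f s).

(* f continues s |-> sum_(n >= 0) (a + n) ^ (- s), from Re s > 1 to the punctured
   half-plane Re s > 0, s <> 1.  That region is open and connected, so by the
   identity theorem f is determined on it, and it is the restriction of the
   continuation to C \ {1}. *)
Definition is_hurwitz_continuation (a : R) (f : C -> C) : Prop :=
  (forall s : C, 1 < Re s ->
     is_series (fun n : nat => cpower (a + INR n) (- s)%C) (f s)) /\
  (forall s : C, 0 < Re s -> s <> RtoC 1 -> analytic_at f s).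

(* The Hurwitz zeta function for a > 0, Re s > 0 and s <> 1; unspecified
   elsewhere. *)
Definition hurwitz_zeta (s : C) (a : R) : C :=
  epsilon (inhabits (fun _ : C => RtoC 0)) (is_hurwitz_continuation a) s.

(* Euler's integral, improper at both ends; meaningful only for x > 0. *)
Definition Gamma (x : R) : R :=
  RInt_gen (fun t : R => Rpower t (x - 1) * exp (- t))
    (at_right 0) (Rbar_locally p_infty).

Definition digamma (x : R) : R := Derive Gamma x / Gamma x.

(* Main.v *)
Require Import Defs.
From Stdlib Require Import Reals List Lra Lia Classical ClassicalEpsilon Factorial.
From Coquelicot Require Import Coquelicot.
Open Scope R_scope.

(* With s(n) = sum_(l < p) floor(n / b^l) - b sum_(1 <= l <= p) floor(n / b^l) for n < b^p,
   summation by parts turns the left-hand side into sums of f(k b^l), 1 <= k <= b^(p-l).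
   These are the right-hand sides because zeta(al, a) - zeta(al, a + 1) = a^(-al) and
   psi(a + 1) - psi(a) = 1 / a.

   The first relation needs the existence and the uniqueness of the continuation.
   Existence: (s - 1) zeta(s, a) = a^(1-s) + sum_n G(a + n, s) with
   G(x, s) = (x+1)^(1-s) - x^(1-s) - (1-s) x^(-s). The Taylor coefficients of G(x, .) at s0
   are second-order Taylor remainders in x, which makes their sum over n a power series.
   Uniqueness: the identity theorem along a path around s = 1.

   The second relation is the quotient of the derivative of Gamma(x + 1) = x Gamma(x);
   convexity of Gamma provides the one-sided derivative. *)

(* [ring] and [field] do not see through the carriers of the canonical structures. *)
Ltac rring := match goal with |- @eq _ ?x ?y => change (@eq R x y) end; ring.
Ltac cring := match goal with |- @eq _ ?x ?y => change (@eq C x y) end; ring.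
Ltac rfield := match goal with |- @eq _ ?x ?y => change (@eq R x y) end; field.

(** The numerator [(s - 1) zeta(s, a)] is the object that is continued, because each term of its
    series is entire in [s]; the division by [s - 1] is then carried out locally, at points other
    than [1]. As analyticity is stated through power series, interchange of sums, division and
    isolation of zeros are all done on coefficients, with absolute majorants. The half-plane
    [Re s > 0] comes from the following count. The k-th coefficient of [G(x, .)] at [s0] is of size
    [x ^ (- 1 - Re s0)] times [L ^ k / k!], where [L] bounds the logarithms near [x]. Summing
    against [r ^ k] turns the logarithms into a factor of order [x ^ r], so any radius [r < Re s0]
    leaves a convergent series over [x = a + n]. The identity theorem is applied to
    [f - g - a ^ (- s)], where [f] and [g] are arbitrary continuations for [a] and [a + 1]. The
    chosen continuation is therefore never compared with the constructed one. *)

Lemma exp_le_mono (u v : R) : u <= v -> exp u <= exp v.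
Proof. intros [h| ->]; [left; now apply exp_increasing|right; reflexivity]. Qed.

(** * The digamma function *)

(** The integral of a nonnegative function grows with the interval, so the improper integral is the
    supremum of the proper ones. In this form inequalities such as convexity pass from compact
    intervals to [Gamma] without any limit. *)
Lemma is_RInt_gen_nonneg_lub (f : R -> R) (M : R) :
  (forall t, 0 < t -> continuous f t) -> (forall t, 0 < t -> 0 <= f t) ->
  (forall a b, 0 < a <= b -> RInt f a b <= M) ->
  exists l, is_RInt_gen f (at_right 0) (Rbar_locally p_infty) l /\
    (forall a b, 0 < a <= b -> RInt f a b <= l) /\
    (forall u, (forall a b, 0 < a <= b -> RInt f a b <= u) -> l <= u).
Proof.
  intros cf pf hM.
  assert (ex : forall a b, 0 < a <= b -> ex_RInt f a b).
  { intros a b hab. apply (@ex_RInt_continuous R_CompleteNormedModule). intros t ht.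
    rewrite Rmin_left in ht by lra. apply cf; lra. }
  destruct (completeness (fun I => exists a b, 0 < a <= b /\ I = RInt f a b)) as [l [ub lub]].
  { exists M. intros I (a & b & hab & ->). auto. }
  { exists (RInt f 1 1), 1, 1. split; [lra|reflexivity]. }
  assert (ubl : forall a b, 0 < a <= b -> RInt f a b <= l).
  { intros a b hab. apply ub. exists a, b; auto. }
  exists l. split; [|split; [exact ubl|]].
  2:{ intros u hu. apply lub. intros I (a & b & hab & ->). auto. }
  intros P [eps hP].
  (* An interval whose integral is within [eps] of the supremum; by nonnegativity every larger
     interval is at least as close. *)
  destruct (classic (exists a b, 0 < a <= b /\ l - eps < RInt f a b)) as [(a & b & hab & hI)|no].
  2:{ exfalso. assert (l <= l - eps).
      { apply lub. intros I (a & b & hab & ->).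
        apply Rnot_lt_le. intros h. apply no. exists a, b; auto. }
      pose proof (cond_pos eps); lra. }
  apply (Filter_prod _ _ _ (fun s => 0 < s < a) (fun t => b < t)).
  { exists (mkposreal a (proj1 hab)). intros s hs hs0. split; [exact hs0|].
    unfold ball in hs; simpl in hs; unfold AbsRing_ball, abs, minus, plus, opp in hs; simpl in hs.
    apply Rabs_def2 in hs; lra. }
  { exists b; auto. }
  intros s t hs ht. exists (RInt f s t). split.
  { apply (@RInt_correct R_CompleteNormedModule), ex; simpl; lra. }
  apply hP. unfold ball; simpl; unfold AbsRing_ball, abs, minus, plus, opp; simpl.
  assert (l1 : RInt f s t = RInt f s a + RInt f a b + RInt f b t).
  { rewrite <- (RInt_Chasles f s a t), <- (RInt_Chasles f a b t) by (apply ex; lra).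
    unfold plus; simpl. ring. }
  assert (0 <= RInt f s a) by (apply RInt_ge_0; [lra|apply ex; lra|intros; apply pf; lra]).
  assert (0 <= RInt f b t) by (apply RInt_ge_0; [lra|apply ex; lra|intros; apply pf; lra]).
  pose proof (ubl s t ltac:(lra)). pose proof (cond_pos eps).
  apply Rabs_def1; lra.
Qed.

Definition gamma_integrand (x t : R) : R := Rpower t (x - 1) * exp (- t).

Lemma gamma_integrand_exp (x t : R) :
  gamma_integrand x t = exp ((x - 1) * ln t - t).
Proof. unfold gamma_integrand, Rpower. rewrite <- exp_plus. f_equal; ring. Qed.

Lemma gamma_integrand_continuous (x t : R) : 0 < t -> continuous (gamma_integrand x) t.
Proof.
  intros ht. apply continuous_ext with (fun u => exp ((x - 1) * ln u - u)).
  { intros u; symmetry; apply gamma_integrand_exp. }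
  apply (@ex_derive_continuous R_AbsRing R_NormedModule). auto_derive. lra.
Qed.

(** This is [ln u <= u - 1] at [u = (1 + t) / c]. It bounds [(1 + t) ^ c * exp (- t)] uniformly in
    [t], which controls the Gamma integrand at infinity. *)
Lemma ln_lin_bound (c t : R) : 0 < c -> 0 < t -> c * ln (1 + t) - t <= c * ln c + 1.
Proof.
  intros hc ht.
  assert (E : ln (1 + t) = ln ((1 + t) / c) + ln c).
  { rewrite <- ln_mult by (try apply Rdiv_lt_0_compat; lra). f_equal; field; lra. }
  assert (H : 0 < (1 + t) / c) by (apply Rdiv_lt_0_compat; lra).
  pose proof (exp_ineq1_le (ln ((1 + t) / c))) as L. rewrite exp_ln in L by exact H.
  assert (c * ln ((1 + t) / c) <= c * ((1 + t) / c - 1)) by (apply Rmult_le_compat_l; lra).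
  replace (c * ((1 + t) / c - 1)) with (1 + t - c) in * by (field; lra).
  rewrite E. lra.
Qed.

(* [K * (t / (1 + t)) ^ x] is a bounded function whose derivative dominates the
   integrand on the whole half-line. *)
Lemma RInt_gamma_integrand_bounded (x : R) : 0 < x ->
  exists M, forall a b, 0 < a <= b -> RInt (gamma_integrand x) a b <= M.
Proof.
  (* The derivative of [(t / (1 + t)) ^ x] is [x * t ^ (x - 1) / (1 + t) ^ (x + 1)]. The exponential
     in [K] is the bound of [ln_lin_bound] at [c = x + 1], and [/ x] removes the factor [x]. *)
  intros hx. set (K := exp ((x + 1) * ln (x + 1) + 1) / x).
  assert (hK : 0 < K) by (apply Rdiv_lt_0_compat; [apply exp_pos|lra]).
  exists K. intros a b hab.
  set (U := fun t => K * exp (x * (ln t - ln (1 + t)))).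
  set (U' := fun t => K * (x * (/ t - / (1 + t)) * exp (x * (ln t - ln (1 + t))))).
  assert (I : is_RInt U' a b (U b - U a)).
  { apply (is_RInt_derive U U').
    - intros t ht. rewrite Rmin_left in ht by lra. unfold U, U'. auto_derive; [lra|].
      unfold Rminus. ring.
    - intros t ht. rewrite Rmin_left in ht by lra.
      apply (@ex_derive_continuous R_AbsRing R_NormedModule). unfold U'. auto_derive. lra. }
  assert (le : RInt (gamma_integrand x) a b <= RInt U' a b).
  { apply RInt_le; [lra| |eexists; exact I|].
    - apply (@ex_RInt_continuous R_CompleteNormedModule). intros t ht.
      rewrite Rmin_left in ht by lra. apply gamma_integrand_continuous; lra.
    - intros t ht. rewrite gamma_integrand_exp. unfold U', K.
      assert (E : exp ((x + 1) * ln (x + 1) + 1) / x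
          * (x * (/ t - / (1 + t)) * exp (x * (ln t - ln (1 + t))))
          = exp ((x + 1) * ln (x + 1) + 1 + ((x - 1) * ln t - (x + 1) * ln (1 + t)))).
      { replace ((x - 1) * ln t - (x + 1) * ln (1 + t))
          with (x * (ln t - ln (1 + t)) + (- ln t + - ln (1 + t))) by ring.
        rewrite !exp_plus, !exp_Ropp, !exp_ln by lra. field. lra. }
      rewrite E. apply exp_le_mono. pose proof (ln_lin_bound (x + 1) t ltac:(lra) ltac:(lra)). lra. }
  rewrite (is_RInt_unique _ _ _ _ I) in le.
  assert (0 <= U a) by (unfold U; apply Rmult_le_pos; [lra|left; apply exp_pos]).
  assert (U b <= K).
  { unfold U. rewrite <- (Rmult_1_r K) at 2. apply Rmult_le_compat_l; [lra|].
    assert (ln b <= ln (1 + b)) by (apply ln_le; lra).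
    apply Rle_trans with (exp 0); [apply exp_le_mono; nra|rewrite exp_0; lra]. }
  lra.
Qed.

Lemma Gamma_lub (x : R) : 0 < x ->
  is_RInt_gen (gamma_integrand x) (at_right 0) (Rbar_locally p_infty) (Gamma x) /\
  (forall a b, 0 < a <= b -> RInt (gamma_integrand x) a b <= Gamma x) /\
  (forall u, (forall a b, 0 < a <= b -> RInt (gamma_integrand x) a b <= u) -> Gamma x <= u).
Proof.
  intros hx. destruct (RInt_gamma_integrand_bounded x hx) as [M hM].
  destruct (is_RInt_gen_nonneg_lub (gamma_integrand x) M) as (l & il & lub).
  - apply gamma_integrand_continuous.
  - intros t _. rewrite gamma_integrand_exp. left; apply exp_pos.
  - exact hM.
  - replace (Gamma x) with l; [split; assumption|].
    symmetry. exact (is_RInt_gen_unique (V := R_CompleteNormedModule) _ _ il).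
Qed.

Lemma Gamma_pos (x : R) : 0 < x -> 0 < Gamma x.
Proof.
  intros hx. apply Rlt_le_trans with (RInt (gamma_integrand x) 1 2).
  - apply RInt_gt_0; [lra| |].
    + intros t _. rewrite gamma_integrand_exp. apply exp_pos.
    + intros t ht. apply gamma_integrand_continuous; lra.
  - apply (Gamma_lub x hx). lra.
Qed.

(** Tangent line at the mean [m]: after division by [exp m], apply [1 + h <= exp h] at [u - m] and
    [v - m], whose weighted mean is zero. *)
Lemma exp_convex (u v th : R) : 0 <= th <= 1 ->
  exp ((1 - th) * u + th * v) <= (1 - th) * exp u + th * exp v.
Proof.
  intros hth. set (m := (1 - th) * u + th * v).
  replace (exp u) with (exp m * exp (u - m)) by (rewrite <- exp_plus; f_equal; ring).
  replace (exp v) with (exp m * exp (v - m)) by (rewrite <- exp_plus; f_equal; ring).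
  pose proof (exp_ineq1_le (u - m)). pose proof (exp_ineq1_le (v - m)).
  pose proof (exp_pos m).
  assert (1 <= (1 - th) * exp (u - m) + th * exp (v - m)).
  { apply Rle_trans with ((1 - th) * (1 + (u - m)) + th * (1 + (v - m))).
    - unfold m. right. ring.
    - apply Rplus_le_compat; apply Rmult_le_compat_l; lra. }
  nra.
Qed.

(** The logarithm of the integrand is affine in the parameter, so the integrand is convex in it for
    each [t]. The inequality is integrated over compact intervals and then passes to the
    supremum. *)
Lemma Gamma_convex (x y th : R) : 0 < x -> 0 < y -> 0 <= th <= 1 ->
  Gamma ((1 - th) * x + th * y) <= (1 - th) * Gamma x + th * Gamma y.
Proof.
  intros hx hy hth. assert (hm : 0 < (1 - th) * x + th * y) by nra.
  apply (Gamma_lub _ hm). intros a b hab.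
  assert (ex : forall w, ex_RInt (gamma_integrand w) a b).
  { intros w. apply (@ex_RInt_continuous R_CompleteNormedModule). intros t ht.
    rewrite Rmin_left in ht by lra. apply gamma_integrand_continuous; lra. }
  pose proof (proj1 (proj2 (Gamma_lub x hx)) a b hab).
  pose proof (proj1 (proj2 (Gamma_lub y hy)) a b hab).
  apply Rle_trans with ((1 - th) * RInt (gamma_integrand x) a b + th * RInt (gamma_integrand y) a b);
    [|apply Rplus_le_compat; apply Rmult_le_compat_l; lra].
  assert (I : is_RInt (fun t => (1 - th) * gamma_integrand x t + th * gamma_integrand y t) a b
    ((1 - th) * RInt (gamma_integrand x) a b + th * RInt (gamma_integrand y) a b)).
  { apply (is_RInt_plus (V := R_NormedModule)); apply (is_RInt_scal (V := R_NormedModule));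
    apply (@RInt_correct R_CompleteNormedModule), ex. }
  rewrite <- (is_RInt_unique _ _ _ _ I).
  apply RInt_le; [lra|apply ex|eexists; exact I|].
  intros t ht. rewrite !gamma_integrand_exp.
  eapply Rle_trans; [|apply exp_convex; exact hth].
  right; f_equal; ring.
Qed.

(** Three-slope inequality. The left half bounds the right-hand difference quotients at [x] from
    below, the right half makes them monotone; together they give a right derivative. *)
Lemma Gamma_slope_incr (u x y w : R) : 0 < u < x -> x < y <= w ->
  (Gamma x - Gamma u) / (x - u) <= (Gamma y - Gamma x) / (y - x) <= (Gamma w - Gamma x) / (w - x).
Proof.
  intros hu hy. split.
  (* The weight that makes [x] the convex combination of [u] and [y]. *)
  - pose proof (Gamma_convex u y ((x - u) / (y - u)) ltac:(lra) ltac:(lra)) as C.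
    assert (h : 0 < (x - u) / (y - u) < 1).
    { split; [apply Rdiv_lt_0_compat; lra|]. apply Rmult_lt_reg_r with (y - u); [lra|].
      unfold Rdiv; rewrite Rmult_assoc, Rinv_l; lra. }
    specialize (C ltac:(lra)).
    replace ((1 - (x - u) / (y - u)) * u + (x - u) / (y - u) * y) with x in C by (field; lra).
    apply Rminus_le. apply (Rmult_le_compat_r (y - u)) in C; [|lra].
    replace (((1 - (x - u) / (y - u)) * Gamma u + (x - u) / (y - u) * Gamma y) * (y - u))
      with ((y - x) * Gamma u + (x - u) * Gamma y) in C by (field; lra).
    replace ((Gamma x - Gamma u) / (x - u) - (Gamma y - Gamma x) / (y - x))
      with ((Gamma x * (y - u) - ((y - x) * Gamma u + (x - u) * Gamma y)) / ((x - u) * (y - x)))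
      by (field; lra).
    apply Rmult_le_reg_r with ((x - u) * (y - x)); [apply Rmult_lt_0_compat; lra|].
    unfold Rdiv; rewrite Rmult_assoc, Rinv_l; [|apply Rgt_not_eq, Rmult_lt_0_compat; lra]. lra.
  - pose proof (Gamma_convex x w ((y - x) / (w - x)) ltac:(lra) ltac:(lra)) as C.
    assert (h : 0 < (y - x) / (w - x) <= 1).
    { split; [apply Rdiv_lt_0_compat; lra|]. apply Rmult_le_reg_r with (w - x); [lra|].
      unfold Rdiv; rewrite Rmult_assoc, Rinv_l; lra. }
    specialize (C ltac:(lra)).
    replace ((1 - (y - x) / (w - x)) * x + (y - x) / (w - x) * w) with y in C by (field; lra).
    apply Rmult_le_reg_r with (y - x); [lra|].
    replace ((Gamma y - Gamma x) / (y - x) * (y - x)) with (Gamma y - Gamma x) by (field; lra).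
    replace ((Gamma w - Gamma x) / (w - x) * (y - x))
      with ((y - x) / (w - x) * (Gamma w - Gamma x)) by (field; lra).
    lra.
Qed.

(** Integration by parts: [F] is [- t ^ x * exp (- t)], whose derivative is the difference of the
    two integrands and which vanishes at both ends. *)
Lemma Gamma_succ (x : R) : 0 < x -> Gamma (x + 1) = x * Gamma x.
Proof.
  intros hx.
  set (F := fun t => - exp (x * ln t - t)).
  assert (dF : forall t, 0 < t ->
    is_derive F t (gamma_integrand (x + 1) t - x * gamma_integrand x t)).
  { intros t ht. unfold F. rewrite !gamma_integrand_exp. auto_derive; [lra|].
    replace (exp ((x - 1) * ln t - t)) with (exp (x * ln t - t) * / t).
    2:{ replace (/ t) with (exp (- ln t)) by (rewrite exp_Ropp, exp_ln; lra).
        rewrite <- exp_plus. f_equal; ring. }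
    replace ((x + 1 - 1) * ln t - t) with (x * ln t - t) by ring.
    unfold Rminus. field. lra. }
  assert (near : forall P : R -> Prop, (forall t, 0 < t -> P t) ->
    filter_prod (at_right 0) (Rbar_locally p_infty) (fun ab : R * R => forall t,
      Rmin (fst ab) (snd ab) <= t <= Rmax (fst ab) (snd ab) -> P t)).
  { intros P hP. apply (Filter_prod _ _ _ (fun s => 0 < s) (fun s => 0 < s)).
    - exists (mkposreal 1 Rlt_0_1). intros s _ hs. exact hs.
    - exists 0. auto.
    - intros s t hs ht u hu. apply hP. simpl in hu.
      assert (0 < Rmin s t) by (apply Rmin_pos; assumption). lra. }
  assert (lim : is_RInt_gen (Derive F) (at_right 0) (Rbar_locally p_infty) (0 - 0)).
  { assert (ex0 : filterlim (fun u => - exp u) (Rbar_locally m_infty) (locally 0)).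
    { replace 0 with (- 0) by ring.
      apply (filterlim_comp _ _ _ exp Ropp _ (locally 0)).
      - exact is_lim_exp_m.
      - exact (filterlim_opp (K := R_AbsRing) (V := R_NormedModule) 0). }
    apply is_RInt_gen_Derive.
    - apply near. intros t ht. eexists. apply dF, ht.
    - apply near. intros t ht.
      apply continuous_ext_loc with (fun t => gamma_integrand (x + 1) t - x * gamma_integrand x t).
      + exists (mkposreal t ht). intros y hy.
        unfold ball in hy; simpl in hy; unfold AbsRing_ball, abs, minus, plus, opp in hy; simpl in hy.
        apply Rabs_def2 in hy. symmetry. apply is_derive_unique, dF. lra.
      + apply (continuous_minus (V := R_NormedModule)).
        * now apply gamma_integrand_continuous.
        * apply (continuous_scal_r (V := R_NormedModule)).
          now apply gamma_integrand_continuous.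
    - apply (filterlim_comp _ _ _ (fun t => x * ln t - t) (fun u => - exp u) _ _ _) with (2 := ex0).
      intros P [M hM]. unfold filtermap.
      exists (mkposreal (exp (M / x)) (exp_pos _)). intros t ht ht0. apply hM.
      unfold ball in ht; simpl in ht; unfold AbsRing_ball, abs, minus, plus, opp in ht; simpl in ht.
      apply Rabs_def2 in ht.
      assert (ln t < M / x) by (rewrite <- (ln_exp (M / x)); apply ln_increasing; lra).
      assert (x * ln t < x * (M / x)) by (apply Rmult_lt_compat_l; lra).
      replace (x * (M / x)) with M in * by (field; lra). lra.
    - apply (filterlim_comp _ _ _ (fun t => x * ln t - t) (fun u => - exp u) _ _ _) with (2 := ex0).
      intros P [M hM]. unfold filtermap.
      (* Write [x * ln t - t] as [((x + 1) * ln t - t) - ln t]. The bracket is at most the constant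
         of [ln_lin_bound], so it suffices that [ln t] exceeds that constant minus [M]. *)
      exists (exp ((x + 1) * ln (x + 1) + 1 - M)). intros t ht. apply hM.
      pose proof (exp_pos ((x + 1) * ln (x + 1) + 1 - M)).
      assert (h : (x + 1) * ln (x + 1) + 1 - M < ln t).
      { rewrite <- (ln_exp ((x + 1) * ln (x + 1) + 1 - M)). apply ln_increasing; lra. }
      pose proof (ln_lin_bound (x + 1) t ltac:(lra) ltac:(lra)).
      assert (ln t <= ln (1 + t)) by (apply ln_le; lra). nra. }
  destruct (Gamma_lub x hx) as [i0 _]. destruct (Gamma_lub (x + 1) ltac:(lra)) as [i1 _].
  assert (i2 := is_RInt_gen_minus _ _ _ _ i1 (is_RInt_gen_scal _ x _ i0)).
  assert (i3 : is_RInt_gen (Derive F) (at_right 0) (Rbar_locally p_infty)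
     (minus (Gamma (x + 1)) (scal x (Gamma x)))).
  { eapply is_RInt_gen_ext; [|exact i2].
    eapply filter_imp; [|apply (near (fun t => Derive F t = gamma_integrand (x + 1) t - x * gamma_integrand x t))].
    - intros ab h t ht. symmetry. apply h. lra.
    - intros t ht. apply is_derive_unique, dF, ht. }
  apply (is_RInt_gen_unique (V := R_CompleteNormedModule)) in lim.
  apply (is_RInt_gen_unique (V := R_CompleteNormedModule)) in i3.
  rewrite lim in i3. unfold minus, plus, opp, scal in i3; simpl in i3. unfold mult in i3; simpl in i3.
  lra.
Qed.

(* [Derive] is a limit along the sequence [1 / (n + 1)], on which the difference
   quotients of a convex function decrease; differentiability is not required. *)
Lemma digamma_succ (x : R) : 0 < x -> digamma (x + 1) = digamma x + 1 / x.
Proof.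
  intros hx.
  set (h := fun n => / (INR n + 1)).
  assert (hh : forall n, 0 < h n).
  { intros n. apply Rinv_0_lt_compat. pose proof (pos_INR n); lra. }
  set (q := fun n => (Gamma (x + h n) - Gamma x) / h n).
  assert (ex : ex_finite_lim_seq q).
  { apply ex_finite_lim_seq_decr with ((Gamma x - Gamma (x / 2)) / (x - x / 2)).
    - intros n. unfold q.
      assert (h (S n) <= h n).
      { apply Rinv_le_contravar; [pose proof (pos_INR n); lra|]. rewrite S_INR; lra. }
      pose proof (hh (S n)).
      pose proof (Gamma_slope_incr (x / 2) x (x + h (S n)) (x + h n) ltac:(lra) ltac:(lra)) as [_ L].
      replace (x + h (S n) - x) with (h (S n)) in L by ring.
      replace (x + h n - x) with (h n) in L by ring. exact L.
    - intros n. pose proof (hh n).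
      pose proof (Gamma_slope_incr (x / 2) x (x + h n) (x + h n) ltac:(lra) ltac:(lra)) as [L _].
      replace (x + h n - x) with (h n) in L by ring. exact L. }
  destruct ex as [v hv].
  assert (D0 : Derive Gamma x = v).
  { unfold Derive, Lim. rewrite (is_lim_seq_unique _ v); [reflexivity|].
    apply is_lim_seq_ext with q; [|exact hv].
    intros n. unfold q, h, Rbar_loc_seq. rewrite Rplus_0_l. reflexivity. }
  assert (h0 : is_lim_seq h 0).
  { apply is_lim_seq_ext with (fun n => / INR (S n)).
    - intros n. unfold h. now rewrite S_INR.
    - apply (is_lim_seq_incr_1 (fun n => / INR n)).
      evar_last; [apply is_lim_seq_inv; [apply is_lim_seq_INR|discriminate]|reflexivity]. }
  (* By the functional equation the quotient at [x + 1] is [Gamma x + h n * q n + x * q n]; the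
     summand [0 * v] is the limit of [h n * q n]. *)
  assert (D1 : Derive Gamma (x + 1) = Gamma x + 0 * v + x * v).
  { unfold Derive, Lim. rewrite (is_lim_seq_unique _ (Gamma x + 0 * v + x * v)); [reflexivity|].
    apply is_lim_seq_ext with (fun n => Gamma x + h n * q n + x * q n).
    - intros n. unfold Rbar_loc_seq. rewrite Rplus_0_l. fold (h n). pose proof (hh n).
      replace (x + 1 + h n) with (x + h n + 1) by ring.
      rewrite !Gamma_succ by lra. unfold q. field. lra.
    - apply is_lim_seq_plus'; [apply is_lim_seq_plus'|];
        [apply is_lim_seq_const|apply is_lim_seq_mult'; assumption|].
      apply is_lim_seq_mult'; [apply is_lim_seq_const|assumption]. }
  unfold digamma. rewrite D1, D0, Gamma_succ by exact hx.
  pose proof (Gamma_pos x hx). field. lra.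
Qed.

(** * Complex series *)

Lemma sum_n_SR (a : nat -> R) (n : nat) : sum_n a (S n) = sum_n a n + a (S n).
Proof. exact (sum_Sn a n). Qed.

Lemma sum_n_SC (a : nat -> C) (n : nat) : sum_n a (S n) = (sum_n a n + a (S n))%C.
Proof. exact (sum_Sn a n). Qed.

Lemma sum_n_0C (a : nat -> C) : sum_n a 0 = a 0%nat.
Proof. exact (sum_O a). Qed.

Lemma sum_n_0R (a : nat -> R) : sum_n a 0 = a 0%nat.
Proof. exact (sum_O a). Qed.

Lemma Re_sum_n (a : nat -> C) (n : nat) : Re (sum_n a n) = sum_n (fun k => Re (a k)) n.
Proof.
  induction n as [|n IH]; [now rewrite sum_n_0C, sum_n_0R|].
  now rewrite sum_n_SC, sum_n_SR, <- IH.
Qed.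

Lemma Im_sum_n (a : nat -> C) (n : nat) : Im (sum_n a n) = sum_n (fun k => Im (a k)) n.
Proof.
  induction n as [|n IH]; [now rewrite sum_n_0C, sum_n_0R|].
  now rewrite sum_n_SC, sum_n_SR, <- IH.
Qed.

Lemma Cmod_sum_n (a : nat -> C) (n : nat) : Cmod (sum_n a n) <= sum_n (fun k => Cmod (a k)) n.
Proof.
  induction n as [|n IH]; [rewrite sum_n_0C, sum_n_0R; lra|].
  rewrite sum_n_SC, sum_n_SR. eapply Rle_trans; [apply Cmod_triangle|lra].
Qed.

Lemma sum_n_le_loc (a b : nat -> R) (n : nat) :
  (forall k, (k <= n)%nat -> a k <= b k) -> sum_n a n <= sum_n b n.
Proof.
  induction n as [|n IH]; intros H; [rewrite !sum_n_0R; auto|].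
  rewrite !sum_n_SR. apply Rplus_le_compat; auto.
Qed.

Lemma sum_n_plusR (a b : nat -> R) (n : nat) :
  sum_n (fun k => a k + b k) n = sum_n a n + sum_n b n.
Proof. exact (sum_n_plus (G := R_AbelianMonoid) a b n). Qed.

Lemma sum_n_plusC (a b : nat -> C) (n : nat) :
  sum_n (fun k => (a k + b k)%C) n = (sum_n a n + sum_n b n)%C.
Proof. exact (sum_n_plus (G := C_AbelianMonoid) a b n). Qed.

Lemma sum_n_scalR (x : R) (a : nat -> R) (n : nat) :
  sum_n (fun k => x * a k) n = x * sum_n a n.
Proof. exact (sum_n_mult_l (K := R_Ring) x a n). Qed.

Lemma im_le_Cmod (z : C) : Rabs (Im z) <= Cmod z.
Proof. eapply Rle_trans; [apply Rmax_r|apply Rmax_Cmod]. Qed.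

Lemma Cmod_le_parts (z : C) : Cmod z <= Rabs (Re z) + Rabs (Im z).
Proof.
  replace z with (RtoC (Re z) + Ci * RtoC (Im z))%C at 1.
  - eapply Rle_trans; [apply Cmod_triangle|].
    rewrite Cmod_mult, Cmod_Ci, !Cmod_R. lra.
  - destruct z as [x y]. unfold Cplus, Cmult, Ci, RtoC, Re, Im; simpl. f_equal; ring.
Qed.

Lemma is_series_C_eps (a : nat -> C) (l : C) :
  is_series a l <->
  forall eps, 0 < eps -> exists N, forall n, (N <= n)%nat -> Cmod (sum_n a n - l)%C < eps.
Proof.
  etransitivity; [apply (filterlim_locally_ball_norm (U := C_NormedModule))|]. split.
  - intros H eps heps. destruct (H (mkposreal eps heps)) as [N hN]. exists N.
    intros n hn. exact (hN n hn).
  - intros H eps. destruct (H eps (cond_pos eps)) as [N hN]. exists N.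
    intros n hn. exact (hN n hn).
Qed.

Lemma is_series_R_eps (a : nat -> R) (l : R) :
  is_series a l <->
  forall eps, 0 < eps -> exists N, forall n, (N <= n)%nat -> Rabs (sum_n a n - l) < eps.
Proof.
  etransitivity; [apply (filterlim_locally_ball_norm (U := R_NormedModule))|]. split.
  - intros H eps heps. destruct (H (mkposreal eps heps)) as [N hN]. exists N. exact hN.
  - intros H eps. destruct (H eps (cond_pos eps)) as [N hN]. exists N. exact hN.
Qed.

Lemma is_series_C_unique (a : nat -> C) (l m : C) : is_series a l -> is_series a m -> l = m.
Proof. apply (filterlim_locally_unique (V := C_NormedModule)). Qed.

Lemma is_series_C_parts (a : nat -> C) (x y : R) :
  is_series (fun n => Re (a n)) x -> is_series (fun n => Im (a n)) y -> is_series a (x, y).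
Proof.
  rewrite !is_series_R_eps, is_series_C_eps. intros hx hy eps heps.
  destruct (hx (eps / 2) ltac:(lra)) as [N1 h1]. destruct (hy (eps / 2) ltac:(lra)) as [N2 h2].
  exists (N1 + N2)%nat. intros n hn.
  specialize (h1 n ltac:(lia)). specialize (h2 n ltac:(lia)).
  rewrite <- Re_sum_n in h1. rewrite <- Im_sum_n in h2.
  eapply Rle_lt_trans; [apply Cmod_le_parts|].
  replace eps with (eps / 2 + eps / 2) by lra.
  apply Rplus_lt_compat; assumption.
Qed.

Definition Csum (a : nat -> C) : C :=
  (Series (fun n => Re (a n)), Series (fun n => Im (a n))).

Lemma is_series_le_R (a : nat -> R) (l : R) (n : nat) :
  (forall k, 0 <= a k) -> is_series a l -> sum_n a n <= l.
Proof.
  intros pos H.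
  assert (mono : forall k, sum_n a n <= sum_n a (n + k)).
  { induction k as [|k IH]; [rewrite Nat.add_0_r; lra|].
    rewrite Nat.add_succ_r, sum_n_SR. specialize (pos (S (n + k))). lra. }
  apply Rnot_lt_le. intros hlt. rewrite is_series_R_eps in H.
  destruct (H (sum_n a n - l) ltac:(lra)) as [N hN].
  specialize (hN (n + N)%nat ltac:(lia)). specialize (mono N).
  apply Rabs_def2 in hN. lra.
Qed.

Lemma is_series_Cmod_le (a : nat -> C) (l : C) (M : R) :
  (forall n, sum_n (fun k => Cmod (a k)) n <= M) -> is_series a l -> Cmod l <= M.
Proof.
  intros hM H. apply Rnot_lt_le. intros hlt. rewrite is_series_C_eps in H.
  destruct (H (Cmod l - M) ltac:(lra)) as [N hN].
  specialize (hN N ltac:(lia)). specialize (hM N).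
  pose proof (Cmod_sum_n a N).
  pose proof (Cmod_triangle (sum_n a N) (l - sum_n a N)%C) as t.
  replace (sum_n a N + (l - sum_n a N))%C with l in t by cring.
  replace (l - sum_n a N)%C with (- (sum_n a N - l))%C in t by cring.
  rewrite Cmod_opp in t. lra.
Qed.

Lemma is_series_Csum (a : nat -> C) :
  ex_series (fun n => Cmod (a n)) -> is_series a (Csum a).
Proof.
  intros H. apply is_series_C_parts; apply Series_correct;
    (eapply (ex_series_le (V := R_CompleteNormedModule)); [|exact H]); intros n.
  - apply re_le_Cmod.
  - apply im_le_Cmod.
Qed.

Lemma ex_series_nonneg_bounded (a : nat -> R) (M : R) :
  (forall n, 0 <= a n) -> (forall n, sum_n a n <= M) -> ex_series a.
Proof.
  intros pos hM.
  destruct (ex_finite_lim_seq_incr (sum_n a) M) as [l hl].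
  - intros n. rewrite sum_n_SR. specialize (pos (S n)). lra.
  - exact hM.
  - exists l. exact hl.
Qed.

(** * Complex power series and their absolute majorants *)

Lemma pow_n_Cpow (w : C) (k : nat) : pow_n (K := C_Ring) w k = (w ^ k)%C.
Proof. induction k as [|k IH]; [reflexivity|]. simpl. rewrite IH. reflexivity. Qed.

Lemma is_pseries_C (c : nat -> C) (w l : C) :
  is_pseries c w l <-> is_series (fun k => (w ^ k * c k)%C) l.
Proof.
  unfold is_pseries. split; apply is_series_ext; intros n;
    rewrite <- pow_n_Cpow; reflexivity.
Qed.

Lemma is_pseries_C_plus (c d : nat -> C) (w l m : C) :
  is_pseries c w l -> is_pseries d w m -> is_pseries (fun k => (c k + d k)%C) w (l + m)%C.
Proof. apply (is_pseries_plus (V := C_NormedModule)). Qed.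

Lemma is_pseries_C_scal (x : C) (c : nat -> C) (w l : C) :
  is_pseries c w l -> is_pseries (fun k => (x * c k)%C) w (x * l)%C.
Proof. apply (is_pseries_scal (V := C_NormedModule)). apply Cmult_comm. Qed.

Lemma is_pseries_C_minus (c d : nat -> C) (w l m : C) :
  is_pseries c w l -> is_pseries d w m -> is_pseries (fun k => (c k - d k)%C) w (l - m)%C.
Proof. apply (is_pseries_minus (V := C_NormedModule)). Qed.

Definition shift (c : nat -> C) (k : nat) : C :=
  match k with O => RtoC 0 | S j => c j end.

Lemma is_pseries_shift (c : nat -> C) (w l : C) :
  is_pseries c w l -> is_pseries (shift c) w (w * l)%C.
Proof.
  intros H. eapply is_pseries_ext; [|exact (is_pseries_incr_1 (V := C_NormedModule) c w l H)].
  intros [|n]; reflexivity.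
Qed.

(** The weighted l1 norm of the coefficients at radius [r] is at most [M]. Stating it on partial
    sums presupposes no limit. *)
Definition majorized (c : nat -> C) (r M : R) : Prop :=
  forall K, sum_n (fun k => Cmod (c k) * r ^ k) K <= M.

Lemma majorized_Cmod (c : nat -> C) (r M : R) (w l : C) :
  Cmod w <= r -> majorized c r M -> is_pseries c w l -> Cmod l <= M.
Proof.
  intros hw hM H. apply is_pseries_C in H. refine (is_series_Cmod_le _ l M _ H).
  intros n. eapply Rle_trans; [|exact (hM n)]. apply sum_n_le_loc. intros k _.
  rewrite Cmod_mult, Cmod_pow, Rmult_comm. apply Rmult_le_compat_l; [apply Cmod_ge_0|].
  apply pow_incr. split; [apply Cmod_ge_0|exact hw].
Qed.

(** Triangle inequality for infinitely many summands in the weighted l1 norm. It is clear for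
    finitely many families; a finite set of coefficients [d k] is then approximated
    simultaneously. *)
Lemma majorized_series (c : nat -> nat -> C) (r : R) (M : nat -> R) (d : nat -> C) :
  0 <= r -> (forall n, majorized (c n) r (M n)) -> ex_series M ->
  (forall k, is_series (fun n => c n k) (d k)) -> majorized d r (Series M).
Proof.
  intros hr hM exM hd K.
  assert (pos : forall n k, 0 <= Cmod (c n k) * r ^ k).
  { intros. apply Rmult_le_pos; [apply Cmod_ge_0|apply pow_le, hr]. }
  assert (fin : forall N K', sum_n (fun k => Cmod (sum_n (fun n => c n k) N) * r ^ k) K'
      <= Series M).
  { intros N K'.
    apply Rle_trans with (sum_n (fun n => sum_n (fun k => Cmod (c n k) * r ^ k) K') N).
    - induction N as [|N IH].
      + rewrite sum_n_0R. apply sum_n_le_loc. intros. rewrite sum_n_0C. lra.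
      + rewrite sum_n_SR. eapply Rle_trans; [|apply Rplus_le_compat_r, IH].
        rewrite <- sum_n_plusR. apply sum_n_le_loc. intros k _.
        rewrite sum_n_SC, <- Rmult_plus_distr_r.
        apply Rmult_le_compat_r; [apply pow_le, hr|apply Cmod_triangle].
    - eapply Rle_trans; [apply sum_n_le_loc; intros n _; apply hM|].
      apply is_series_le_R; [|apply Series_correct, exM].
      intros n. eapply Rle_trans; [|apply (hM n 0%nat)]. rewrite sum_n_0R. apply pos. }
  apply le_epsilon. intros eps heps.
  assert (close : forall K' e, 0 < e -> exists N, forall k, (k <= K')%nat ->
      Cmod (d k) * r ^ k <= Cmod (sum_n (fun n => c n k) N) * r ^ k + e).
  { intros K' e he.
    assert (ev : exists N, forall k n, (k <= K')%nat -> (N <= n)%nat ->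
      Cmod (sum_n (fun n => c n k) n - d k)%C * r ^ k <= e).
    { assert (one : forall k, exists N, forall n, (N <= n)%nat ->
        Cmod (sum_n (fun n => c n k) n - d k)%C * r ^ k <= e).
      { intros k. destruct (proj1 (is_series_C_eps _ _) (hd k) (e / (r ^ k + 1))) as [N hN].
        - apply Rdiv_lt_0_compat; [exact he|]. pose proof (pow_le r k hr). lra.
        - exists N. intros n hn. specialize (hN n hn). pose proof (pow_le r k hr).
          apply Rle_trans with (e / (r ^ k + 1) * (r ^ k + 1)); [|right; field; lra].
          apply Rmult_le_compat; try lra; apply Cmod_ge_0. }
      induction K' as [|K' [N hN]].
      - destruct (one 0%nat) as [N hN]. exists N. intros k n hk hn.
        replace k with 0%nat by lia. now apply hN.
      - destruct (one (S K')) as [N' hN']. exists (N + N')%nat. intros k n hk hn.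
        destruct (Nat.eq_dec k (S K')) as [->|ne]; [apply hN'; lia|apply hN; lia]. }
    destruct ev as [N hN]. exists N. intros k hk. specialize (hN k N hk (le_n N)).
    pose proof (Cmod_triangle (sum_n (fun n => c n k) N) (- (sum_n (fun n => c n k) N - d k))%C) as t.
    rewrite Cmod_opp in t.
    replace (sum_n (fun n => c n k) N + - (sum_n (fun n => c n k) N - d k))%C with (d k) in t by cring.
    apply (Rmult_le_compat_r (r ^ k)) in t; [|apply pow_le, hr]. lra. }
  (* One [N] serves all [k <= K]; each of the [K + 1] terms may lose an equal share of [eps]. *)
  destruct (close K (eps / INR (S K))) as [N hN].
  { apply Rdiv_lt_0_compat; [exact heps|apply lt_0_INR; lia]. }
  eapply Rle_trans; [apply sum_n_le_loc; exact hN|].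
  rewrite sum_n_plusR.
  apply Rplus_le_compat; [apply fin|].
  rewrite sum_n_const. right. field. apply not_0_INR; lia.
Qed.

(** Weierstrass double series theorem. Up to [N] there is a finite sum of power series; the
    remaining families are small uniformly in the order [K], because their joint norm is at most the
    tail of [Series M]. *)
Lemma is_pseries_series (c : nat -> nat -> C) (r : R) (M : nat -> R) (d f : nat -> C) (w F : C) :
  Cmod w <= r -> (forall n, majorized (c n) r (M n)) -> ex_series M ->
  (forall k, is_series (fun n => c n k) (d k)) ->
  (forall n, is_pseries (c n) w (f n)) -> is_series f F -> is_pseries d w F.
Proof.
  intros hw hM exM hd hf hF. assert (hr : 0 <= r) by (pose proof (Cmod_ge_0 w); lra).
  apply is_pseries_C, is_series_C_eps. intros eps heps.
  destruct (proj1 (is_series_C_eps _ _) hF (eps / 3) ltac:(lra)) as [N1 h1].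
  destruct (proj1 (is_series_R_eps _ _) (Series_correct _ exM) (eps / 3) ltac:(lra)) as [N2 h2].
  set (N := (N1 + N2)%nat).
  specialize (h1 N ltac:(lia)). specialize (h2 N ltac:(lia)).
  assert (part : is_pseries (fun k => sum_n (fun n => c n k) N) w (sum_n f N)).
  { clear h1 h2. induction N as [|N IH].
    - rewrite sum_n_0C. eapply is_pseries_ext; [|apply hf]. intros; now rewrite sum_n_0C.
    - rewrite sum_n_SC. eapply is_pseries_ext; [|exact (is_pseries_C_plus _ _ _ _ _ IH (hf (S N)))].
      intros; now rewrite sum_n_SC. }
  assert (tail : majorized (fun k => d k - sum_n (fun n => c n k) N)%C r (eps / 3)).
  { intros K. eapply Rle_trans.
    - apply (majorized_series (fun n => c (S N + n)%nat) r (fun n => M (S N + n)%nat)); auto.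
      + now apply (ex_series_incr_n M (S N)).
      + intros k. apply (is_series_incr_n (V := C_NormedModule) (fun n => c n k) (S N)); [lia|].
        replace (plus _ _) with (d k); [apply hd|].
        change (@eq C (d k) (d k - sum_n (fun n => c n k) N + sum_n (fun n => c n k) N)%C). ring.
    - rewrite (Series_incr_n M (S N)) in h2 by (try lia; exact exM).
      simpl pred in h2. rewrite sum_n_Reals in h2. apply Rabs_def2 in h2. simpl in *. lra. }
  destruct (proj1 (is_series_C_eps _ _) (proj1 (is_pseries_C _ _ _) part) (eps / 3) ltac:(lra))
    as [K0 hK0].
  exists K0. intros K hK. specialize (hK0 K hK).
  assert (first : Cmod (sum_n (fun k => (w ^ k * (d k - sum_n (fun n => c n k) N))%C) K) <= eps / 3).
  { eapply Rle_trans; [apply Cmod_sum_n|]. eapply Rle_trans; [|exact (tail K)].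
    apply sum_n_le_loc. intros k _. rewrite Cmod_mult, Cmod_pow, Rmult_comm.
    apply Rmult_le_compat_l; [apply Cmod_ge_0|].
    apply pow_incr. split; [apply Cmod_ge_0|exact hw]. }
  replace (sum_n (fun k => (w ^ k * d k)%C) K - F)%C with
    (sum_n (fun k => (w ^ k * (d k - sum_n (fun n => c n k) N))%C) K
     + ((sum_n (fun k => (w ^ k * sum_n (fun n => c n k) N)%C) K - sum_n f N) + (sum_n f N - F)))%C.
  - eapply Rle_lt_trans; [apply Cmod_triangle|].
    pose proof (Cmod_triangle (sum_n (fun k => (w ^ k * sum_n (fun n => c n k) N)%C) K - sum_n f N)%C
      (sum_n f N - F)%C). lra.
  - replace (sum_n (fun k => (w ^ k * d k)%C) K) with
      (sum_n (fun k => (w ^ k * (d k - sum_n (fun n => c n k) N))%C) K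
       + sum_n (fun k => (w ^ k * sum_n (fun n => c n k) N)%C) K)%C; [cring|].
    rewrite <- sum_n_plusC. apply sum_n_ext. intros k. cring.
Qed.

(** * Powers and their Taylor coefficients *)

Lemma cexp_plus (u v : C) : cexp (u + v)%C = (cexp u * cexp v)%C.
Proof.
  unfold cexp, Cmult, Cplus, Re, Im; simpl.
  rewrite exp_plus, cos_plus, sin_plus. f_equal; ring.
Qed.

Lemma cexp_scal (s : C) (r : R) :
  cexp (s * RtoC r)%C = (exp (Re s * r) * cos (Im s * r), exp (Re s * r) * sin (Im s * r)).
Proof.
  unfold cexp, Cmult, RtoC, Re, Im; simpl.
  now rewrite !Rmult_0_r, Rminus_0_r, Rplus_0_l.
Qed.

Lemma Cmod_cexp (u : C) : Cmod (cexp u) = exp (Re u).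
Proof.
  transitivity (sqrt (exp (Re u) ^ 2)); [|apply sqrt_pow2; left; apply exp_pos].
  unfold cexp, Cmod; simpl. f_equal. pose proof (sin2_cos2 (Im u)) as h. unfold Rsqr in h.
  transitivity (exp (Re u) * exp (Re u) * (sin (Im u) * sin (Im u) + cos (Im u) * cos (Im u)));
    [ring|]. rewrite h. ring.
Qed.

Lemma cpower_plus (x : R) (s t : C) : cpower x (s + t)%C = (cpower x s * cpower x t)%C.
Proof. unfold cpower. rewrite <- cexp_plus. f_equal. ring. Qed.

Lemma Cmod_cpower (x : R) (s : C) : Cmod (cpower x s) = Rpower x (Re s).
Proof.
  unfold cpower, Rpower. rewrite Cmod_cexp. f_equal.
  unfold Cmult, RtoC, Re; simpl. ring.
Qed.

Lemma cpower_R (x a : R) : cpower x (RtoC a) = RtoC (Rpower x a).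
Proof.
  unfold cpower. rewrite cexp_scal. unfold Rpower, RtoC, Re, Im; simpl.
  rewrite Rmult_0_l, cos_0, sin_0. f_equal; ring.
Qed.

Lemma cpower_1 (x : R) : 0 < x -> cpower x (RtoC 1) = RtoC x.
Proof. intros hx. now rewrite cpower_R, Rpower_1. Qed.

(** * Complex-valued functions of a real variable and Taylor's formula *)

Definition is_derive_RC (f : R -> C) (t : R) (l : C) : Prop :=
  is_derive (fun u => Re (f u)) t (Re l) /\ is_derive (fun u => Im (f u)) t (Im l).

Lemma is_derive_RC_eq (f : R -> C) (t : R) (l m : C) :
  is_derive_RC f t l -> l = m -> is_derive_RC f t m.
Proof. now intros H <-. Qed.

Lemma is_derive_RC_scal (z : C) (f : R -> C) (t : R) (l : C) :
  is_derive_RC f t l -> is_derive_RC (fun u => (z * f u)%C) t (z * l)%C.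
Proof.
  intros [hr hi]. unfold is_derive_RC, Cmult, Re, Im in *; simpl. split.
  - apply (is_derive_minus (V := R_NormedModule)); apply is_derive_scal; assumption.
  - apply (is_derive_plus (V := R_NormedModule)); apply is_derive_scal; assumption.
Qed.

Lemma is_derive_RC_minus (f g : R -> C) (t : R) (l m : C) :
  is_derive_RC f t l -> is_derive_RC g t m ->
  is_derive_RC (fun u => (f u - g u)%C) t (l - m)%C.
Proof.
  intros [hr hi] [kr ki]. split;
    apply (is_derive_minus (V := R_NormedModule)); assumption.
Qed.

Lemma is_derive_RC_mult_R (f : R -> C) (g : R -> R) (t : R) (l : C) (m : R) :
  is_derive_RC f t l -> is_derive g t m ->
  is_derive_RC (fun u => (f u * RtoC (g u))%C) t (l * RtoC (g t) + f t * RtoC m)%C.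
Proof.
  intros [hr hi] hg.
  assert (main : forall (h : R -> R) dh, is_derive h t dh ->
    is_derive (fun u => h u * g u) t (dh * g t + h t * m)).
  { intros h dh hh. apply (is_derive_mult (K := R_AbsRing) h g); auto. exact Rmult_comm. }
  split.
  - apply is_derive_ext with (fun u => Re (f u) * g u).
    { intros u. unfold Cmult, RtoC, Re; simpl. ring. }
    replace (Re _) with (Re l * g t + Re (f t) * m) by
      (unfold Cmult, Cplus, RtoC, Re; simpl; ring). now apply main.
  - apply is_derive_ext with (fun u => Im (f u) * g u).
    { intros u. unfold Cmult, RtoC, Re; simpl. unfold Im. ring. }
    replace (Im _) with (Im l * g t + Im (f t) * m) by
      (unfold Cmult, Cplus, RtoC, Im; simpl; ring). now apply main.
Qed.

Lemma is_derive_RC_comp (f : R -> C) (g : R -> R) (t : R) (l : C) (m : R) :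
  is_derive_RC f (g t) l -> is_derive g t m ->
  is_derive_RC (fun u => f (g u)) t (RtoC m * l)%C.
Proof.
  intros [hr hi] hg. split.
  - replace (Re _) with (m * Re l) by (unfold Cmult, RtoC, Re; simpl; ring).
    exact (is_derive_comp (fun v => Re (f v)) g t _ _ hr hg).
  - replace (Im _) with (m * Im l) by (unfold Cmult, RtoC, Im; simpl; ring).
    exact (is_derive_comp (fun v => Im (f v)) g t _ _ hi hg).
Qed.

Lemma is_derive_RC_cexp (s : C) (t : R) :
  is_derive_RC (fun u => cexp (s * RtoC u)%C) t (s * cexp (s * RtoC t))%C.
Proof.
  rewrite cexp_scal. split.
  - apply is_derive_ext with (fun u => exp (Re s * u) * cos (Im s * u)).
    { intros u. now rewrite cexp_scal. }
    unfold Cmult, Re, Im; simpl. auto_derive; [easy|]. ring.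
  - apply is_derive_ext with (fun u => exp (Re s * u) * sin (Im s * u)).
    { intros u. now rewrite cexp_scal. }
    unfold Cmult, Re, Im; simpl. auto_derive; [easy|]. ring.
Qed.

(** The successive derivatives are given as a sequence [f]. They are required beyond the left
    endpoint, down to [lo], because differentiability at [0] is two-sided. *)
Lemma Taylor_Lagrange_R (f : nat -> R -> R) (n : nat) (lo M : R) : lo < 0 ->
  (forall j t, (j <= n)%nat -> lo < t -> is_derive (f j) t (f (S j) t)) ->
  (forall t, 0 <= t <= 1 -> Rabs (f (S n) t) <= M) ->
  Rabs (f 0%nat 1 - sum_n (fun k => f k 0 / INR (fact k)) n) <= M / INR (fact (S n)).
Proof.
  intros hlo hf hM.
  assert (nearby : forall t, lo < t -> locally t (fun u => lo < u)).
  { intros t ht. exact (open_gt lo t ht). }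
  assert (D : forall k t, (k <= S n)%nat -> lo < t -> Derive_n (f 0%nat) k t = f k t).
  { induction k as [|k IH]; intros t hk ht; [reflexivity|]. simpl.
    apply is_derive_unique. apply is_derive_ext_loc with (f k).
    - apply (filter_imp (fun u => lo < u)); [|now apply nearby].
      intros u hu. symmetry. apply IH; [lia|exact hu].
    - apply hf; [lia|exact ht]. }
  destruct (Taylor_Lagrange (f 0%nat) n 0 1 Rlt_0_1) as (zeta & hz & E).
  { intros t ht [|k] hk; [exact I|]. simpl. exists (f (S k) t).
    apply is_derive_ext_loc with (f k).
    - apply (filter_imp (fun u => lo < u)); [|apply nearby; lra].
      intros u hu. symmetry. apply D; [lia|exact hu].
    - apply hf; [lia|lra]. }
  rewrite E, sum_n_Reals, D by (try lia; lra).
  replace (sum_f_R0 _ n) with (sum_f_R0 (fun k => f k 0 / INR (fact k)) n).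
  2:{ apply sum_eq. intros k hk. rewrite D by (try lia; lra).
      rewrite Rminus_0_r, pow1. unfold Rdiv. ring. }
  rewrite Rminus_0_r, pow1.
  replace (_ + _ - _) with (f (S n) zeta / INR (fact (S n))) by (unfold Rdiv; ring).
  pose proof (INR_fact_lt_0 (S n)).
  unfold Rdiv. rewrite Rabs_mult, (Rabs_right (/ _)) by (left; now apply Rinv_0_lt_compat).
  apply Rmult_le_compat_r; [left; now apply Rinv_0_lt_compat|]. apply hM; lra.
Qed.

(** Real and imaginary parts have different intermediate points, so they are estimated separately;
    this is the origin of the factor 2. *)
Lemma Taylor_Lagrange_C (f : nat -> R -> C) (n : nat) (lo M : R) : lo < 0 ->
  (forall j t, (j <= n)%nat -> lo < t -> is_derive_RC (f j) t (f (S j) t)) ->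
  (forall t, 0 <= t <= 1 -> Cmod (f (S n) t) <= M) ->
  Cmod (f 0%nat 1 - sum_n (fun k => (f k 0 * RtoC (/ INR (fact k)))%C) n)%C
    <= 2 * (M / INR (fact (S n))).
Proof.
  intros hlo hf hM.
  assert (hr := Taylor_Lagrange_R (fun j t => Re (f j t)) n lo M hlo
    (fun j t h1 h2 => proj1 (hf j t h1 h2))
    (fun t ht => Rle_trans _ _ _ (re_le_Cmod _) (hM t ht))).
  assert (hi := Taylor_Lagrange_R (fun j t => Im (f j t)) n lo M hlo
    (fun j t h1 h2 => proj2 (hf j t h1 h2))
    (fun t ht => Rle_trans _ _ _ (im_le_Cmod _) (hM t ht))).
  eapply Rle_trans; [apply Cmod_le_parts|].
  replace (2 * (M / INR (fact (S n)))) with (M / INR (fact (S n)) + M / INR (fact (S n))) by ring.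
  apply Rplus_le_compat.
  - eapply Rle_trans; [right|exact hr]. f_equal.
    change (Re (f 0%nat 1) - Re (sum_n (fun k => (f k 0 * RtoC (/ INR (fact k)))%C) n)
      = Re (f 0%nat 1) - sum_n (fun k => Re (f k 0) / INR (fact k)) n).
    rewrite Re_sum_n. f_equal. apply sum_n_ext. intros k.
    unfold Cmult, RtoC, Re, Rdiv; simpl. ring.
  - eapply Rle_trans; [right|exact hi]. f_equal.
    change (Im (f 0%nat 1) - Im (sum_n (fun k => (f k 0 * RtoC (/ INR (fact k)))%C) n)
      = Im (f 0%nat 1) - sum_n (fun k => Im (f k 0) / INR (fact k)) n).
    rewrite Im_sum_n. f_equal. apply sum_n_ext. intros k.
    unfold Cmult, RtoC, Im, Rdiv; simpl. ring.
Qed.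

(** Taylor's formula for [t |-> cexp (z * t)] on [[0, 1]], where the modulus stays below
    [exp (Rabs (Re z))]. *)
Lemma is_series_cexp (z : C) : is_series (fun k => (z ^ k * RtoC (/ INR (fact k)))%C) (cexp z).
Proof.
  apply is_series_C_eps. intros eps heps.
  set (A := exp (Rabs (Re z))).
  assert (hA : 0 < A) by apply exp_pos.
  assert (lim : is_lim_seq (fun n => Cmod z ^ n / INR (fact n)) 0).
  { apply is_lim_seq_Reals. intros e he.
    destruct (cv_speed_pow_fact (Cmod z) e he) as [N hN]. exists N. exact hN. }
  apply is_lim_seq_spec in lim.
  destruct (lim (mkposreal (eps / (2 * A)) ltac:(apply Rdiv_lt_0_compat; lra))) as [N hN].
  exists N. intros n hn. specialize (hN (S n) ltac:(lia)). simpl pos in hN.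
  rewrite Rminus_0_r in hN. apply Rle_lt_trans with (1 := Rle_abs _) in hN.
  assert (T := Taylor_Lagrange_C (fun j t => (z ^ j * cexp (z * RtoC t))%C) n (-1)
    (Cmod z ^ S n * A) ltac:(lra)).
  assert (T1 := T ltac:(intros j t _ _; eapply is_derive_RC_eq;
    [apply is_derive_RC_scal, is_derive_RC_cexp|simpl; ring])).
  clear T.
  assert (B : forall t, 0 <= t <= 1 -> Cmod (z ^ S n * cexp (z * RtoC t))%C <= Cmod z ^ S n * A).
  { intros t ht. rewrite Cmod_mult, Cmod_pow, Cmod_cexp.
    apply Rmult_le_compat_l; [apply pow_le, Cmod_ge_0|]. apply exp_le_mono.
    replace (Re (z * RtoC t)%C) with (Re z * t) by (unfold Cmult, RtoC, Re; simpl; ring).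
    pose proof (Rle_abs (Re z)). pose proof (Rabs_pos (Re z)). nra. }
  specialize (T1 B). cbv beta in T1.
  rewrite Cmult_1_r in T1. simpl Cpow at 1 in T1. rewrite Cmult_1_l in T1.
  rewrite <- Cmod_opp.
  replace (- _)%C with (cexp z - sum_n (fun k => (z ^ k * RtoC (/ INR (fact k)))%C) n)%C by cring.
  eapply Rle_lt_trans; [right|eapply Rle_lt_trans; [exact T1|]].
  - do 2 f_equal. apply sum_n_ext. intros k.
    rewrite cexp_scal, !Rmult_0_r, exp_0, cos_0, sin_0, !Rmult_1_l.
    change (1, 0) with (RtoC 1). now rewrite Cmult_1_r.
  - apply (Rmult_lt_compat_l (2 * A)) in hN; [|lra].
    replace (2 * A * (eps / (2 * A))) with eps in hN by (field; lra).
    eapply Rle_lt_trans; [right|exact hN]. unfold Rdiv. ring.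
Qed.

(* Taylor coefficients at [w = 0] of [w |-> x ^ (s - w)]. *)
Definition power_coef (x : R) (s : C) (k : nat) : C :=
  (cpower x s * RtoC ((- ln x) ^ k / INR (fact k)))%C.

Lemma is_pseries_power_coef (x : R) (s w : C) :
  is_pseries (power_coef x s) w (cpower x (s - w)%C).
Proof.
  apply is_pseries_C.
  replace (cpower x (s - w)%C) with (cpower x s * cexp (w * RtoC (- ln x)))%C.
  - eapply is_series_ext; [|exact (is_series_scal (V := C_NormedModule) (cpower x s) _ _
      (is_series_cexp (w * RtoC (- ln x))%C))].
    intros k. change (@eq C (cpower x s * ((w * RtoC (- ln x)) ^ k * RtoC (/ INR (fact k))))%C
      (w ^ k * power_coef x s k)%C).
    unfold power_coef, Rdiv. rewrite RtoC_mult, RtoC_pow, Cpow_mult_l. ring.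
  - unfold cpower. rewrite <- cexp_plus. f_equal. rewrite RtoC_opp. ring.
Qed.

(* Multiplication by [b - w] on power series in [w]. *)
Definition mul_lin (b : C) (c : nat -> C) (k : nat) : C := (b * c k - shift c k)%C.

Lemma is_pseries_mul_lin (b : C) (c : nat -> C) (w l : C) :
  is_pseries c w l -> is_pseries (mul_lin b c) w ((b - w) * l)%C.
Proof.
  intros H. replace ((b - w) * l)%C with (b * l - w * l)%C by ring.
  apply is_pseries_C_minus; [now apply is_pseries_C_scal|now apply is_pseries_shift].
Qed.

(** Coefficient of [w ^ k] in the rule that [x ^ (s - w)] has [x]-derivative
    [(s - w) * x ^ (s - 1 - w)]. *)
Lemma is_derive_power_coef (x : R) (s : C) (k : nat) : 0 < x ->
  is_derive_RC (fun u => power_coef u s k) x (mul_lin s (power_coef x (s - RtoC 1)%C) k).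
Proof.
  intros hx.
  assert (pred : cpower x s = (cpower x (s - RtoC 1) * RtoC x)%C).
  { rewrite <- (cpower_1 x hx). rewrite <- cpower_plus. f_equal. ring. }
  assert (dp : is_derive_RC (fun u => cpower u s) x (s * cpower x (s - RtoC 1))%C).
  { eapply is_derive_RC_eq.
    - unfold cpower. apply (is_derive_RC_comp (fun r => cexp (s * RtoC r)%C) ln x (s * cexp (s * RtoC (ln x)))%C (/ x)).
      + apply is_derive_RC_cexp.
      + apply is_derive_Reals, derivable_pt_lim_ln, hx.
    - fold (cpower x s). rewrite pred, RtoC_inv by lra. field.
      intros h. apply RtoC_inj in h. lra. }
  set (l := match k with O => 0 | S j => - (/ x) * ((- ln x) ^ j / INR (fact j)) end).
  assert (dl : is_derive (fun u => (- ln u) ^ k / INR (fact k)) x l).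
  { unfold l. destruct k as [|j].
    - apply is_derive_ext with (fun _ => 1); [intros u; simpl; field|apply (@is_derive_const R_AbsRing R_NormedModule)].
    - auto_derive; [lra|].
      change (match j with O => 1 | S _ => INR j + 1 end) with (INR (S j)).
      change (fact j + j * fact j)%nat with (S j * fact j)%nat. rewrite mult_INR.
      field. repeat split; try lra; [apply INR_fact_neq_0|apply not_0_INR; lia]. }
  eapply is_derive_RC_eq.
  - exact (is_derive_RC_mult_R _ _ _ _ _ dp dl).
  - unfold mul_lin, power_coef, l. destruct k as [|j]; simpl shift.
    + ring.
    + rewrite pred, !RtoC_mult, RtoC_opp, RtoC_inv by lra. field.
      intros h. apply RtoC_inj in h. lra.
Qed.

(** * Existence of the continuation *)

Lemma Rpower_pos (x y : R) : 0 < Rpower x y.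
Proof. apply exp_pos. Qed.

Lemma Rpower_nonpos_antitone (x y e : R) : 0 < x <= y -> e <= 0 -> Rpower y e <= Rpower x e.
Proof.
  intros hxy he. apply exp_le_mono. assert (ln x <= ln y) by (apply ln_le; lra). nra.
Qed.

(** The integral test in discrete form: the right-hand side telescopes. It follows from [((y + 1) /
    y) ^ d >= 1 + d * ln ((y + 1) / y)] and [ln ((y + 1) / y) >= / (y + 1)]. *)
Lemma Rpower_step (d y : R) : 0 < y -> 0 < d ->
  d * Rpower (y + 1) (- 1 - d) <= Rpower y (- d) - Rpower (y + 1) (- d).
Proof.
  intros hy hd.
  assert (E : Rpower y (- d) = Rpower (y + 1) (- d) * exp (d * ln ((y + 1) / y))).
  { unfold Rpower. rewrite <- exp_plus. f_equal. rewrite ln_div by lra. ring. }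
  assert (L : / (y + 1) <= ln ((y + 1) / y)).
  { pose proof (exp_ineq1_le (ln (y / (y + 1)))) as h.
    rewrite exp_ln in h by (apply Rdiv_lt_0_compat; lra).
    rewrite ln_div in * by lra.
    replace (/ (y + 1)) with (1 - y / (y + 1)) by (field; lra). lra. }
  pose proof (exp_ineq1_le (d * ln ((y + 1) / y))) as X.
  assert (d * / (y + 1) <= d * ln ((y + 1) / y)) by (apply Rmult_le_compat_l; lra).
  replace (Rpower (y + 1) (- 1 - d)) with (Rpower (y + 1) (- d) * / (y + 1)).
  - rewrite E. pose proof (Rpower_pos (y + 1) (- d)). nra.
  - replace (- 1 - d) with (- d + - (1)) by ring.
    rewrite Rpower_plus, (Rpower_Ropp _ 1), Rpower_1 by lra. reflexivity.
Qed.

Lemma ex_series_Rpower (a d : R) : 0 < a -> 0 < d ->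
  ex_series (fun n => Rpower (a + INR n) (- 1 - d)).
Proof.
  intros ha hd.
  assert (hn : forall n, 0 < a + INR n) by (intros n; pose proof (pos_INR n); lra).
  apply ex_series_nonneg_bounded with (Rpower a (- 1 - d) + Rpower a (- d) / d).
  { intros n. left. apply Rpower_pos. }
  assert (tele : forall n, sum_n (fun n => Rpower (a + INR n) (- 1 - d)) n
    <= Rpower a (- 1 - d) + (Rpower a (- d) - Rpower (a + INR n) (- d)) / d).
  { induction n as [|n IH].
    - rewrite sum_n_0R, Rplus_0_r. unfold Rdiv. lra.
    - rewrite sum_n_SR, S_INR. pose proof (Rpower_step d (a + INR n) (hn n) hd) as st.
      replace (a + (INR n + 1)) with (a + INR n + 1) by ring.
      assert (Rpower (a + INR n + 1) (- 1 - d) <=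
        (Rpower (a + INR n) (- d) - Rpower (a + INR n + 1) (- d)) / d).
      { apply Rmult_le_reg_l with d; [lra|]. unfold Rdiv.
        rewrite (Rmult_comm _ (/ d)), <- Rmult_assoc, Rinv_r by lra. lra. }
      unfold Rdiv in *. lra. }
  intros n. eapply Rle_trans; [apply tele|]. apply Rplus_le_compat_l.
  apply Rmult_le_compat_r; [left; now apply Rinv_0_lt_compat|].
  pose proof (Rpower_pos (a + INR n) (- d)). lra.
Qed.

Lemma Rpower_neg_lim (a e : R) : 0 < a -> e < 0 -> forall eps, 0 < eps ->
  exists N, forall n, (N <= n)%nat -> Rpower (a + INR n) e < eps.
Proof.
  intros ha he eps heps. destruct (INR_unbounded (exp (ln eps / e))) as [N hN].
  exists N. intros n hn. apply le_INR in hn.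
  assert (h : ln eps / e < ln (a + INR n)).
  { rewrite <- (ln_exp (ln eps / e)). apply ln_increasing; [apply exp_pos|lra]. }
  unfold Rpower. rewrite <- (exp_ln eps heps). apply exp_increasing.
  apply (Rmult_lt_gt_compat_neg_l e) in h; [|exact he].
  replace (e * (ln eps / e)) with (ln eps) in h by (field; lra). lra.
Qed.

(* [(s - 1)] times the difference between [x ^ (- s)] and the integral of
   [y ^ (- s)] over [x <= y <= x + 1]. *)
Definition zeta_term (x : R) (s : C) : C :=
  (cpower (x + 1) (1 - s) - cpower x (1 - s) - (1 - s) * cpower x (- s))%C.

Definition zeta_coef (x : R) (s0 : C) (k : nat) : C :=
  (power_coef (x + 1) (1 - s0) k - power_coef x (1 - s0) k
   - mul_lin (1 - s0) (power_coef x (1 - s0 - 1)) k)%C.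

Lemma is_pseries_zeta_coef (x : R) (s0 w : C) :
  is_pseries (zeta_coef x s0) w (zeta_term x (s0 + w)%C).
Proof.
  unfold zeta_term.
  replace (1 - (s0 + w))%C with (1 - s0 - w)%C by ring.
  replace (- (s0 + w))%C with (1 - s0 - 1 - w)%C by ring.
  apply is_pseries_C_minus; [apply is_pseries_C_minus|apply is_pseries_mul_lin];
    apply is_pseries_power_coef.
Qed.

(** Multiplication by [B + w] on nonnegative majorants, the counterpart of [mul_lin] after the
    triangle inequality. At radius [r] it costs a factor [B + r]. *)
Definition mul_lin_bound (B : R) (e : nat -> R) (k : nat) : R :=
  B * e k + match k with O => 0 | S j => e j end.

Lemma Cmod_mul_lin (b : C) (c : nat -> C) (e : nat -> R) (k : nat) :
  (forall k, Cmod (c k) <= e k) -> Cmod (mul_lin b c k) <= mul_lin_bound (Cmod b) e k.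
Proof.
  intros H. unfold mul_lin, mul_lin_bound, Cminus. eapply Rle_trans; [apply Cmod_triangle|].
  rewrite Cmod_opp, Cmod_mult. apply Rplus_le_compat.
  - apply Rmult_le_compat_l; [apply Cmod_ge_0|apply H].
  - destruct k as [|k]; [simpl; rewrite Cmod_0; lra|apply H].
Qed.

Lemma sum_mul_lin_bound (B r M : R) (e : nat -> R) : 0 <= B -> 0 <= r ->
  (forall k, 0 <= e k) -> (forall K, sum_n (fun k => e k * r ^ k) K <= M) ->
  forall K, sum_n (fun k => mul_lin_bound B e k * r ^ k) K <= (B + r) * M.
Proof.
  intros hB hr he hM K.
  assert (hM0 : 0 <= M).
  { eapply Rle_trans; [|apply (hM 0%nat)]. rewrite sum_n_0R. simpl. rewrite Rmult_1_r. apply he. }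
  rewrite (sum_n_ext _ (fun k => B * (e k * r ^ k)
     + match k with O => 0 | S j => e j end * r ^ k)) by (intros k; unfold mul_lin_bound; rring).
  rewrite sum_n_plusR, sum_n_scalR, Rmult_plus_distr_r. apply Rplus_le_compat.
  { apply Rmult_le_compat_l; auto. }
  destruct K as [|K].
  { rewrite sum_n_0R, Rmult_0_l. now apply Rmult_le_pos. }
  apply Rle_trans with (r * sum_n (fun k => e k * r ^ k) K); [right|now apply Rmult_le_compat_l].
  induction K as [|K IH].
  - rewrite sum_n_SR, !sum_n_0R. simpl. rring.
  - rewrite sum_n_SR, IH, sum_n_SR. simpl. rring.
Qed.

Lemma is_derive_RC_mul_lin (b : C) (F : nat -> R -> C) (d : nat -> C) (t : R) (k : nat) :
  (forall k, is_derive_RC (F k) t (d k)) ->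
  is_derive_RC (fun u => mul_lin b (fun j => F j u) k) t (mul_lin b d k).
Proof.
  intros H. apply is_derive_RC_minus; [now apply is_derive_RC_scal|].
  destruct k as [|k]; [|apply H].
  split; exact (@is_derive_const R_AbsRing R_NormedModule 0 t).
Qed.

(** With [b = 1 - s0], [f 0 t] is the k-th coefficient of [(x + t) ^ (b - w)], and [zeta_coef] is
    its value at [1] minus its linear Taylor polynomial at [0]. The second derivative brings the
    factors [b - w] and [b - 1 - w], hence the two nested bounds. *)
Lemma zeta_coef_le (x : R) (s0 : C) (e : nat -> R) : 0 < x ->
  (forall y k, x <= y <= x + 1 -> Cmod (power_coef y (1 - s0 - 1 - 1) k) <= e k) ->
  forall k, Cmod (zeta_coef x s0 k)
    <= mul_lin_bound (Cmod (1 - s0)) (mul_lin_bound (Cmod (1 - s0 - 1)) e) k.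
Proof.
  intros hx he k. set (b := (1 - s0)%C) in *.
  set (f := fun (j : nat) (t : R) => match j with
    | O => power_coef (x + t) b k
    | S O => mul_lin b (power_coef (x + t) (b - 1)) k
    | _ => mul_lin b (mul_lin (b - 1) (power_coef (x + t) (b - 1 - 1))) k
    end).
  assert (chain : forall s j t, - x < t ->
    is_derive_RC (fun u => power_coef (x + u) s j) t (mul_lin s (power_coef (x + t) (s - 1)) j)).
  { intros s j t ht. eapply is_derive_RC_eq.
    - apply (is_derive_RC_comp (fun y => power_coef y s j) (fun u => x + u) t
        (mul_lin s (power_coef (x + t) (s - 1)) j) 1).
      + apply is_derive_power_coef. lra.
      + auto_derive; [easy|ring].
    - ring. }
  assert (T := Taylor_Lagrange_C f 1 (- x)
    (mul_lin_bound (Cmod b) (mul_lin_bound (Cmod (b - 1)) e) k) ltac:(lra)).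
  replace (zeta_coef x s0 k) with
    (f 0%nat 1 - sum_n (fun k => (f k 0 * RtoC (/ INR (fact k)))%C) 1)%C.
  (* The factor 2 of [Taylor_Lagrange_C] cancels against [fact 2]. *)
  - eapply Rle_trans; [apply T|right; simpl; field].
    + intros [|[|j]] t hj ht; [| |lia].
      * now apply chain.
      * apply (is_derive_RC_mul_lin b (fun j u => power_coef (x + u) (b - 1) j)).
        intros j. now apply chain.
    + intros t ht. apply Cmod_mul_lin. intros j. apply Cmod_mul_lin. intros i. apply he. lra.
  - rewrite sum_n_SC, sum_n_0C. simpl. unfold zeta_coef. fold b.
    rewrite Rplus_0_r, Rinv_1. ring.
Qed.

Lemma sum_exp_le (u : R) (K : nat) : 0 <= u -> sum_n (fun k => u ^ k / INR (fact k)) K <= exp u.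
Proof.
  intros hu. apply is_series_le_R.
  - intros k. apply Rmult_le_pos; [now apply pow_le|].
    left. apply Rinv_0_lt_compat, INR_fact_lt_0.
  - eapply is_series_ext; [|exact (proj1 (is_pseries_R _ _ _) (is_exp_Reals u))].
    intros k. apply Rmult_comm.
Qed.

(** The exponent [- 1 - Re s0] is negative, so the power is largest at the left end [x]. The
    logarithms give [L ^ k / k!], which sums against [r ^ k] to at most [exp (r * L)]. *)
Lemma zeta_coef_majorized (x L r : R) (s0 : C) : 0 < x -> 0 < r -> 0 < Re s0 ->
  (forall y, x <= y <= x + 1 -> Rabs (ln y) <= L) ->
  majorized (zeta_coef x s0) r ((Cmod (1 - s0) + r) * ((Cmod (1 - s0 - 1) + r)
    * (Rpower x (- 1 - Re s0) * exp (r * L)))).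
Proof.
  intros hx hr hs hL.
  assert (hL0 : 0 <= L).
  { eapply Rle_trans; [apply Rabs_pos|]. apply (hL x); lra. }
  assert (hF : forall k, 0 < INR (fact k)) by (intros k; apply INR_fact_lt_0).
  assert (hX : 0 < Rpower x (- 1 - Re s0)) by apply Rpower_pos.
  set (e := fun k => Rpower x (- 1 - Re s0) * (L ^ k / INR (fact k))).
  assert (he : forall k, 0 <= e k).
  { intros k. unfold e, Rdiv. apply Rmult_le_pos; [lra|].
    apply Rmult_le_pos; [now apply pow_le|]. left. now apply Rinv_0_lt_compat. }
  assert (le : forall k, Cmod (zeta_coef x s0 k)
      <= mul_lin_bound (Cmod (1 - s0)) (mul_lin_bound (Cmod (1 - s0 - 1)) e) k).
  { apply zeta_coef_le; [exact hx|]. intros y k hy. unfold power_coef, e.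
    rewrite Cmod_mult, Cmod_cpower, Cmod_R.
    replace (Re (1 - s0 - 1 - 1)%C) with (- 1 - Re s0) by
      (unfold Cminus, Cplus, Copp, RtoC, Re; simpl; ring).
    apply Rmult_le_compat.
    - left; apply Rpower_pos.
    - apply Rabs_pos.
    - apply Rpower_nonpos_antitone; lra.
    - unfold Rdiv. rewrite Rabs_mult, (Rabs_right (/ _)) by (left; now apply Rinv_0_lt_compat).
      apply Rmult_le_compat_r; [left; now apply Rinv_0_lt_compat|].
      rewrite <- RPow_abs, Rabs_Ropp. apply pow_incr. split; [apply Rabs_pos|now apply hL]. }
  intros K. eapply Rle_trans.
  { apply sum_n_le_loc. intros k _. apply Rmult_le_compat_r; [apply pow_le; lra|apply le]. }
  apply sum_mul_lin_bound; [apply Cmod_ge_0|lra| |].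
  { intros k. unfold mul_lin_bound. apply Rplus_le_le_0_compat.
    - apply Rmult_le_pos; [apply Cmod_ge_0|apply he].
    - destruct k; [lra|apply he]. }
  apply sum_mul_lin_bound; [apply Cmod_ge_0|lra|exact he|].
  intros K'. unfold e.
  rewrite (sum_n_ext _ (fun k => Rpower x (- 1 - Re s0) * ((r * L) ^ k / INR (fact k)))).
  2:{ intros k. rewrite Rpow_mult_distr. unfold Rdiv. rring. }
  rewrite sum_n_scalR. apply Rmult_le_compat_l; [lra|].
  apply sum_exp_le. apply Rmult_le_pos; lra.
Qed.

Lemma zeta_coef_summable (a r : R) (s0 : C) : 0 < a -> 0 < r < Re s0 ->
  exists M : nat -> R, ex_series M /\
    forall n, majorized (zeta_coef (a + INR n) s0) r (M n).
Proof.
  (* For [x >= a], [B * x] dominates both [x + 1] and [/ a]. Hence [ln (B * x)] bounds [Rabs (ln y)]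
     on [[x, x + 1]], even where [y < 1], and [exp (r * ln (B * x))] is [(B * x) ^ r]. *)
  intros ha hr. set (B := 1 + / a + / a * / a).
  assert (ia : 0 < / a) by now apply Rinv_0_lt_compat.
  assert (hB : 0 < B) by (unfold B; nra).
  set (K := (Cmod (1 - s0) + r) * (Cmod (1 - s0 - 1) + r) * Rpower B r).
  exists (fun n => K * Rpower (a + INR n) (- 1 - (Re s0 - r))). split.
  { apply (ex_series_scal (V := R_NormedModule)). apply ex_series_Rpower; lra. }
  intros n. pose proof (pos_INR n). set (x := a + INR n).
  assert (hx : a <= x) by (unfold x; lra).
  replace (K * Rpower x (- 1 - (Re s0 - r))) with ((Cmod (1 - s0) + r) * ((Cmod (1 - s0 - 1) + r)
    * (Rpower x (- 1 - Re s0) * exp (r * ln (B * x))))).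
  - apply zeta_coef_majorized; try lra. intros y hy.
    assert (xa : 1 <= x * / a).
    { apply Rmult_le_reg_r with a; [lra|]. rewrite Rmult_assoc, Rinv_l; lra. }
    assert (ln y <= ln (B * x)).
    { apply ln_le; [lra|]. unfold B. nra. }
    assert (- ln y <= ln (B * x)).
    { rewrite <- ln_Rinv by lra. apply ln_le; [apply Rinv_0_lt_compat; lra|].
      apply Rle_trans with (/ a); [apply Rinv_le_contravar; lra|]. unfold B. nra. }
    apply Rabs_le. lra.
  - unfold K. change (exp (r * ln (B * x))) with (Rpower (B * x) r).
    rewrite <- Rpower_mult_distr by lra.
    replace (- 1 - (Re s0 - r)) with (- 1 - Re s0 + r) by ring.
    rewrite Rpower_plus. ring.
Qed.

Definition zeta_numerator (a : R) (s : C) : C :=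
  (cpower a (1 - s) + Csum (fun n => zeta_term (a + INR n) s))%C.

Lemma zeta_terms_summable (a : R) (s : C) : 0 < a -> 0 < Re s ->
  is_series (fun n => zeta_term (a + INR n) s) (Csum (fun n => zeta_term (a + INR n) s)).
Proof.
  intros ha hs. destruct (zeta_coef_summable a (Re s / 2) s ha ltac:(lra)) as (M & exM & hM).
  apply is_series_Csum. eapply (ex_series_le (V := R_CompleteNormedModule)); [|exact exM].
  intros n. unfold norm; simpl. unfold abs; simpl.
  rewrite Rabs_right by (apply Rle_ge, Cmod_ge_0).
  (* The expansion at [s] itself, evaluated at [w = 0]: the majorant of the coefficients also bounds
     the value. *)
  apply (majorized_Cmod _ (Re s / 2) (M n) (RtoC 0) _ ltac:(rewrite Cmod_0; lra) (hM n)).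
  replace s with (s + 0)%C at 2 by ring. apply is_pseries_zeta_coef.
Qed.

Lemma zeta_numerator_analytic (a : R) (s0 : C) : 0 < a -> 0 < Re s0 ->
  analytic_at (zeta_numerator a) s0.
Proof.
  intros ha hs. set (r := Re s0 / 2).
  assert (hr : 0 < r < Re s0) by (unfold r; lra).
  destruct (zeta_coef_summable a r s0 ha hr) as (M & exM & hM).
  exists (fun k => power_coef a (1 - s0) k + Csum (fun n => zeta_coef (a + INR n) s0 k))%C, r.
  split; [lra|]. intros s hsr. apply is_pseries_C_plus.
  - replace (1 - s)%C with (1 - s0 - (s - s0))%C by ring. apply is_pseries_power_coef.
  - apply (is_pseries_series (fun n => zeta_coef (a + INR n) s0) r M _
      (fun n => zeta_term (a + INR n) s)); auto.
    + lra.
    + intros k. apply is_series_Csum.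
      eapply (ex_series_le (V := R_CompleteNormedModule));
        [|exact (ex_series_scal_r (/ r ^ k) M exM)].
      intros n. unfold norm; simpl. unfold abs; simpl.
      rewrite Rabs_right by (apply Rle_ge, Cmod_ge_0).
      pose proof (pow_lt r k (proj1 hr)).
      apply Rmult_le_reg_r with (r ^ k); [lra|]. rewrite Rmult_assoc, Rinv_l, Rmult_1_r by lra.
      eapply Rle_trans; [|exact (hM n k)].
      destruct k as [|k]; [rewrite sum_n_0R; lra|]. rewrite sum_n_SR.
      assert (0 <= sum_n (fun k => Cmod (zeta_coef (a + INR n) s0 k) * r ^ k) k); [|lra].
      apply Rle_trans with (sum_n (fun _ => 0) k).
      * rewrite sum_n_const. lra.
      * apply sum_n_le_loc. intros j _. apply Rmult_le_pos; [apply Cmod_ge_0|apply pow_le; lra].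
    + intros n. replace s with (s0 + (s - s0))%C at 2 by ring. apply is_pseries_zeta_coef.
    + apply zeta_terms_summable; [exact ha|].
      pose proof (re_le_Cmod (s - s0)%C) as h.
      assert (h2 : Rabs (Re (s - s0)%C) < r) by lra. apply Rabs_def2 in h2.
      replace (Re (s - s0)%C) with (Re s - Re s0) in h2 by
        (unfold Cminus, Cplus, Copp, Re; simpl; ring).
      unfold r in h2. lra.
Qed.

(** * Division by [s - s1] and the continuation itself *)

Lemma is_series_C_bounded (a : nat -> C) (l : C) : is_series a l ->
  exists B, 0 <= B /\ forall n, Cmod (a n) <= B.
Proof.
  intros H. destruct (filterlim_bounded (V := C_NormedModule) (sum_n a) (ex_intro _ l H)) as [B hB].
  change (forall n, Cmod (sum_n a n) <= B) in hB.
  assert (hB0 : 0 <= B) by (eapply Rle_trans; [apply Cmod_ge_0|apply (hB 0%nat)]).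
  exists (B + B). split; [lra|]. intros [|n].
  - specialize (hB 0%nat). rewrite sum_n_0C in hB. lra.
  - replace (a (S n)) with (sum_n a (S n) + - sum_n a n)%C by (rewrite sum_n_SC; cring).
    eapply Rle_trans; [apply Cmod_triangle|]. rewrite Cmod_opp. apply Rplus_le_compat; apply hB.
Qed.

(* Cauchy's estimate, in the form that plain convergence provides. *)
Lemma is_pseries_coef_bounded (c : nat -> C) (r : R) (l : C) : 0 < r ->
  is_pseries c (RtoC r) l -> exists B, 0 <= B /\ forall k, Cmod (c k) * r ^ k <= B.
Proof.
  intros hr H. apply is_pseries_C, is_series_C_bounded in H. destruct H as (B & hB & H).
  exists B. split; [exact hB|]. intros k. specialize (H k).
  rewrite Cmod_mult, Cmod_pow, Cmod_R, Rabs_right in H by lra. lra.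
Qed.

Lemma pow_lt_eventually (q B eps : R) : 0 <= q < 1 -> 0 <= B -> 0 < eps ->
  exists N, forall n, (N <= n)%nat -> B * q ^ n < eps.
Proof.
  intros hq hB heps.
  destruct (pow_lt_1_zero q ltac:(rewrite Rabs_right; lra) (eps / (B + 1))) as [N hN].
  { apply Rdiv_lt_0_compat; lra. }
  exists N. intros n hn. specialize (hN n hn).
  rewrite Rabs_right in hN by (apply Rle_ge, pow_le; lra).
  pose proof (pow_le q n (proj1 hq)).
  apply (Rmult_lt_compat_l (B + 1)) in hN; [|lra].
  replace ((B + 1) * (eps / (B + 1))) with eps in hN by (field; lra). nra.
Qed.

(** The recursive solution [q] of [(D + w) * q = c] as power series in [w]; here [D + w] is [s - s1]
    with [w = s - s0]. *)
Fixpoint quotient_coef (D : C) (c : nat -> C) (k : nat) : C :=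
  match k with
  | O => (c 0%nat / D)%C
  | S j => ((c (S j) - quotient_coef D c j) / D)%C
  end.

Lemma analytic_at_div (f : C -> C) (s0 s1 : C) : s0 <> s1 ->
  analytic_at f s0 -> analytic_at (fun s => f s / (s - s1))%C s0.
Proof.
  intros hne (c & r & hr & hc). set (D := (s0 - s1)%C).
  assert (hD : D <> 0).
  { intros h. apply hne. replace s0 with (D + s1)%C by (unfold D; ring). rewrite h. ring. }
  pose proof (proj1 (Cmod_gt_0 D) hD) as hDm.
  (* [r / 2] keeps the real point [p] inside the disc of convergence, which bounds the coefficients;
     [Cmod D / 2] keeps the disc away from [s1] and makes the recursion below contract. *)
  set (p := Rmin (r / 2) (Cmod D / 2)).
  assert (hp : 0 < p) by (apply Rmin_pos; lra).
  assert (hpr : p <= r / 2) by apply Rmin_l.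
  assert (hpD : p <= Cmod D / 2) by apply Rmin_r.
  assert (at_p := hc (s0 + RtoC p)%C).
  replace (s0 + p - s0)%C with (RtoC p) in at_p by ring.
  rewrite Cmod_R, Rabs_right in at_p by lra. specialize (at_p ltac:(lra)).
  destruct (is_pseries_coef_bounded c p _ hp at_p) as (B & hB & bound).
  set (q := quotient_coef D c).
  assert (eq0 : c 0%nat = (D * q 0%nat)%C) by (unfold q; simpl; field; exact hD).
  assert (eqS : forall k, c (S k) = (D * q (S k) + q k)%C).
  { intros k. unfold q; simpl. field. exact hD. }
  (* The bound reproduces itself: [B] from [c (S k)] plus at most
     [Cmod D / 2 * (2 * B / Cmod D) = B] from [q k], divided by [Cmod D]. *)
  assert (qb : forall k, Cmod (q k) * p ^ k <= 2 * B / Cmod D).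
  { induction k as [|k IH].
    - specialize (bound 0%nat). rewrite eq0, Cmod_mult in bound. simpl in *.
      apply Rmult_le_reg_l with (Cmod D); [exact hDm|].
      replace (Cmod D * (2 * B / Cmod D)) with (2 * B) by (field; lra). lra.
    - specialize (bound (S k)).
      assert (t : Cmod D * Cmod (q (S k)) <= Cmod (c (S k)) + Cmod (q k)).
      { rewrite <- Cmod_mult. replace (D * q (S k))%C with (c (S k) + - q k)%C
          by (rewrite eqS; ring).
        eapply Rle_trans; [apply Cmod_triangle|]. rewrite Cmod_opp. lra. }
      pose proof (pow_lt p (S k) hp) as pk.
      apply (Rmult_le_compat_r (p ^ S k)) in t; [|lra].
      apply Rmult_le_reg_l with (Cmod D); [exact hDm|].
      replace (Cmod D * (2 * B / Cmod D)) with (2 * B) by (field; lra).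
      assert (p * (Cmod (q k) * p ^ k) <= Cmod D / 2 * (2 * B / Cmod D)).
      { apply Rmult_le_compat; try lra.
        apply Rmult_le_pos; [apply Cmod_ge_0|apply pow_le; lra]. }
      replace (Cmod D / 2 * (2 * B / Cmod D)) with B in * by (field; lra).
      simpl in *. lra. }
  exists q, p. split; [exact hp|]. intros s hs. set (w := (s - s0)%C) in *.
  specialize (hc s ltac:(fold w; lra)). fold w in hc.
  replace (s - s1)%C with (D + w)%C by (unfold D, w; ring).
  assert (hDw : Cmod D / 2 <= Cmod (D + w)%C).
  { pose proof (Cmod_triangle (D + w) (- w)%C) as t. rewrite Cmod_opp in t.
    replace (D + w + - w)%C with D in t by ring. lra. }
  assert (hDw0 : (D + w)%C <> 0) by (apply Cmod_gt_0; lra).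
  apply is_pseries_C in hc. apply is_pseries_C, is_series_C_eps. intros eps heps.
  (* The product telescopes; the boundary term [w ^ S K * q K] tends to [0] because [Cmod w < p]. *)
  assert (part : forall K, sum_n (fun k => (w ^ k * c k)%C) K
      = ((D + w) * sum_n (fun k => (w ^ k * q k)%C) K - w ^ S K * q K)%C).
  { induction K as [|K IH].
    - rewrite !sum_n_0C, eq0. simpl. cring.
    - rewrite !sum_n_SC, IH, eqS. simpl. cring. }
  set (Q := 2 * B / Cmod D) in *.
  assert (hQ : 0 <= Q) by (unfold Q; apply Rmult_le_pos; [lra|left; now apply Rinv_0_lt_compat]).
  destruct (proj1 (is_series_C_eps _ _) hc (eps / 2 * Cmod (D + w))) as [N1 h1].
  { apply Rmult_lt_0_compat; lra. }
  destruct (pow_lt_eventually (Cmod w / p) (Q * Cmod w) (eps / 2 * Cmod (D + w))) as [N2 h2].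
  { pose proof (Cmod_ge_0 w). split; [apply Rmult_le_pos; [lra|left; now apply Rinv_0_lt_compat]|].
    apply Rmult_lt_reg_r with p; [exact hp|]. unfold Rdiv. rewrite Rmult_assoc, Rinv_l; lra. }
  { apply Rmult_le_pos; [exact hQ|apply Cmod_ge_0]. }
  { apply Rmult_lt_0_compat; lra. }
  exists (N1 + N2)%nat. intros K hK. specialize (h1 K ltac:(lia)). specialize (h2 K ltac:(lia)).
  apply Rmult_lt_reg_r with (Cmod (D + w)); [lra|]. rewrite <- Cmod_mult.
  replace ((sum_n (fun k => (w ^ k * q k)%C) K - f s / (D + w)) * (D + w))%C
    with ((sum_n (fun k => (w ^ k * c k)%C) K - f s) + w ^ S K * q K)%C
    by (rewrite part; field; exact hDw0).
  eapply Rle_lt_trans; [apply Cmod_triangle|].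
  replace (eps * Cmod (D + w)) with (eps / 2 * Cmod (D + w) + eps / 2 * Cmod (D + w)) by field.
  apply Rplus_lt_compat; [exact h1|]. eapply Rle_lt_trans; [|exact h2].
  rewrite Cmod_mult, Cmod_pow. simpl. unfold Rdiv. rewrite Rpow_mult_distr, pow_inv.
  specialize (qb K). pose proof (pow_lt p K hp) as pk.
  assert (Cmod (q K) <= Q * / p ^ K).
  { apply Rmult_le_reg_r with (p ^ K); [exact pk|]. rewrite Rmult_assoc, Rinv_l; lra. }
  pose proof (Cmod_ge_0 w). pose proof (pow_le (Cmod w) K (Cmod_ge_0 w)).
  replace (Q * Cmod w * (Cmod w ^ K * / p ^ K)) with (Cmod w * Cmod w ^ K * (Q * / p ^ K)) by ring.
  apply Rmult_le_compat_l; [now apply Rmult_le_pos|assumption].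
Qed.

Lemma hurwitz_continuation_exists (a : R) : 0 < a ->
  is_hurwitz_continuation a (fun s => zeta_numerator a s / (s - 1))%C.
Proof.
  intros ha. split.
  - intros s hs. apply is_series_C_eps. intros eps heps.
    assert (hs1 : (s - 1)%C <> 0).
    { intros h. apply (f_equal Re) in h.
      unfold Cminus, Cplus, Copp, RtoC, Re in *; simpl in *. lra. }
    pose proof (proj1 (Cmod_gt_0 _) hs1) as hm.
    (* The increments of [x ^ (1 - s)] telescope. For [Re s > 1] the upper end tends to [0], and
       what remains identifies the numerator with [s - 1] times the Dirichlet-type series. *)
    assert (part : forall N, sum_n (fun n => zeta_term (a + INR n) s) N
      = (cpower (a + 1 + INR N) (1 - s) - cpower a (1 - s)
         + (s - 1) * sum_n (fun n => cpower (a + INR n) (- s)) N)%C).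
    { induction N as [|N IH].
      - rewrite !sum_n_0C. unfold zeta_term. simpl. rewrite !Rplus_0_r. cring.
      - rewrite !sum_n_SC, IH. unfold zeta_term.
        replace (a + INR (S N)) with (a + 1 + INR N) by (rewrite S_INR; ring).
        replace (a + 1 + INR (S N)) with (a + 1 + INR N + 1) by (rewrite S_INR; ring). cring. }
    destruct (proj1 (is_series_C_eps _ _) (zeta_terms_summable a s ha ltac:(lra))
      (eps / 2 * Cmod (s - 1))) as [N1 h1].
    { apply Rmult_lt_0_compat; lra. }
    destruct (Rpower_neg_lim (a + 1) (1 - Re s) ltac:(lra) ltac:(lra) (eps / 2 * Cmod (s - 1)))
      as [N2 h2].
    { apply Rmult_lt_0_compat; lra. }
    exists (N1 + N2)%nat. intros n hn. specialize (h1 n ltac:(lia)). specialize (h2 n ltac:(lia)).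
    apply Rmult_lt_reg_r with (Cmod (s - 1)); [lra|]. rewrite <- Cmod_mult.
    replace ((sum_n (fun n => cpower (a + INR n) (- s)) n - zeta_numerator a s / (s - 1)) * (s - 1))%C
      with ((sum_n (fun n => zeta_term (a + INR n) s) n - Csum (fun n => zeta_term (a + INR n) s))
        + - cpower (a + 1 + INR n) (1 - s))%C
      by (rewrite part; unfold zeta_numerator; field; exact hs1).
    eapply Rle_lt_trans; [apply Cmod_triangle|]. rewrite Cmod_opp, Cmod_cpower.
    replace (Re (1 - s)%C) with (1 - Re s)
      by (unfold Cminus, Cplus, Copp, RtoC, Re; simpl; ring).
    lra.
  - intros s hs hs1. apply analytic_at_div; [exact hs1|]. now apply zeta_numerator_analytic.
Qed.

(** * Uniqueness of the continuation *)

Lemma sum_geom_half (q : R) (n : nat) : 0 <= q <= 1 / 2 -> sum_n (fun k => q ^ k) n <= 2.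
Proof.
  intros hq. enough (sum_n (fun k => q ^ k) n <= 2 - (1 / 2) ^ n) by
    (pose proof (pow_le (1 / 2) n ltac:(lra)); lra).
  induction n as [|n IH]; [rewrite sum_n_0R; simpl; lra|].
  rewrite sum_n_SR. pose proof (pow_incr q (1 / 2) (S n) hq) as h. simpl in *. lra.
Qed.

(** At a zero [w], [c 0] equals minus the rest of the series, which is at most [2 * B * Cmod w / p];
    this tends to [0] with [w]. Asking for the expansion only off [0] allows the next lemma to
    divide by [w]. *)
Lemma pseries_zeros_coef0 (c : nat -> C) (g : C -> C) (r : R) : 0 < r ->
  (forall w, 0 < Cmod w < r -> is_pseries c w (g w)) ->
  (forall d, 0 < d -> exists w, 0 < Cmod w < d /\ g w = RtoC 0) -> c 0%nat = RtoC 0.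
Proof.
  intros hr hg zeros. set (p := r / 2).
  assert (hp : 0 < p < r) by (unfold p; lra).
  assert (at_p := hg (RtoC p)). rewrite Cmod_R, Rabs_right in at_p by lra.
  destruct (is_pseries_coef_bounded c p _ (proj1 hp) (at_p hp)) as (B & hB & bound).
  apply Cmod_eq_0, Rle_antisym; [|apply Cmod_ge_0]. apply Rnot_lt_le. intros pos.
  (* Small enough for [2 * B * d / p < Cmod (c 0)]; the [+ 1] covers [B = 0]. *)
  set (d := Cmod (c 0%nat) * p / (2 * B + 1)).
  assert (hd : 0 < d) by (apply Rdiv_lt_0_compat; [apply Rmult_lt_0_compat|]; lra).
  destruct (zeros (Rmin (p / 2) d)) as (w & hw & gw); [apply Rmin_pos; lra|].
  pose proof (Rmin_l (p / 2) d). pose proof (Rmin_r (p / 2) d).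
  assert (hs := hg w ltac:(lra)). rewrite gw in hs. apply is_pseries_C in hs.
  assert (hs' : is_series (fun k => (w ^ S k * c (S k))%C) (- c 0%nat)%C).
  { apply (is_series_incr_1 (V := C_NormedModule) (fun k => (w ^ k * c k)%C)).
    replace (plus _ _) with (RtoC 0); [exact hs|]. simpl.
    change (@eq C 0 (- c 0%nat + 1 * c 0%nat)%C). ring. }
  set (q := Cmod w / p).
  assert (hq : 0 <= q <= 1 / 2).
  { unfold q. split; [apply Rmult_le_pos; [lra|left; apply Rinv_0_lt_compat; lra]|].
    apply Rmult_le_reg_r with p; [lra|]. unfold Rdiv. rewrite (Rmult_assoc (Cmod w)), Rinv_l; lra. }
  assert (le : Cmod (- c 0%nat)%C <= B * q * 2).
  { refine (is_series_Cmod_le _ _ _ _ hs'). intros n.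
    apply Rle_trans with (sum_n (fun k => B * q * q ^ k) n).
    - apply sum_n_le_loc. intros k _. rewrite Cmod_mult, Cmod_pow.
      specialize (bound (S k)). pose proof (pow_lt p (S k) (proj1 hp)) as pk.
      replace (B * q * q ^ k) with (Cmod w ^ S k * (B * / p ^ S k)).
      + apply Rmult_le_compat_l; [apply pow_le, Cmod_ge_0|].
        apply Rmult_le_reg_r with (p ^ S k); [exact pk|]. rewrite (Rmult_assoc B), Rinv_l; lra.
      + rewrite Rmult_assoc. change (q * q ^ k) with (q ^ S k). unfold q, Rdiv.
        rewrite Rpow_mult_distr, pow_inv. ring.
    - rewrite sum_n_scalR. apply Rmult_le_compat_l; [apply Rmult_le_pos; lra|].
      now apply sum_geom_half. }
  rewrite Cmod_opp in le.
  assert (qd : q < Cmod (c 0%nat) / (2 * B + 1)).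
  { unfold q. apply Rmult_lt_reg_r with p; [lra|]. unfold Rdiv. rewrite (Rmult_assoc (Cmod w)), Rinv_l by lra.
    unfold d in *. lra. }
  apply (Rmult_lt_compat_r (2 * B + 1)) in qd; [|lra].
  replace (Cmod (c 0%nat) / (2 * B + 1) * (2 * B + 1)) with (Cmod (c 0%nat)) in qd by (field; lra).
  lra.
Qed.

(** Once [c 0 = 0], the function [g w / w] has the shifted coefficients and the same zeros off
    [0]. *)
Lemma pseries_zeros_coef (k : nat) (c : nat -> C) (g : C -> C) (r : R) : 0 < r ->
  (forall w, 0 < Cmod w < r -> is_pseries c w (g w)) ->
  (forall d, 0 < d -> exists w, 0 < Cmod w < d /\ g w = RtoC 0) -> c k = RtoC 0.
Proof.
  revert c g. induction k as [|k IH]; intros c g hr hg zeros.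
  - exact (pseries_zeros_coef0 c g r hr hg zeros).
  - assert (c0 := pseries_zeros_coef0 c g r hr hg zeros).
    apply (IH (fun k => c (S k)) (fun w => / w * (g w - c 0%nat))%C hr).
    + intros w hw. apply (is_pseries_decr_1 (V := C_NormedModule) c w (/ w)%C (g w)).
      * apply Cinv_l, Cmod_gt_0; lra.
      * now apply hg.
    + intros d hd. destruct (zeros d hd) as (w & hw & gw). exists w.
      split; [exact hw|]. rewrite gw, c0. ring.
Qed.

Lemma analytic_at_isolated_zeros (h : C -> C) (s0 : C) : analytic_at h s0 ->
  (forall d, 0 < d -> exists s, 0 < Cmod (s - s0) < d /\ h s = RtoC 0) ->
  exists d, 0 < d /\ forall s, Cmod (s - s0) < d -> h s = RtoC 0.
Proof.
  intros (c & r & hr & hc) zeros.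
  assert (c0 : forall k, c k = RtoC 0).
  { intros k. apply (pseries_zeros_coef k c (fun w => h (s0 + w)%C) r hr).
    - intros w hw. specialize (hc (s0 + w)%C). replace (s0 + w - s0)%C with w in hc by ring.
      apply hc; lra.
    - intros d hd. destruct (zeros d hd) as (s & hs & hz). exists (s - s0)%C.
      split; [exact hs|]. now replace (s0 + (s - s0))%C with s by ring. }
  exists r. split; [exact hr|]. intros s hs.
  apply Cmod_eq_0, Rle_antisym; [|apply Cmod_ge_0].
  refine (majorized_Cmod c (Cmod (s - s0)) 0 _ _ (Rle_refl _) _ (hc s hs)).
  intros K. apply Rle_trans with (sum_n (fun _ => 0) K); [|rewrite sum_n_const; lra].
  apply sum_n_le_loc. intros k _. rewrite c0, Cmod_0. lra.
Qed.

(** Connectedness of [[0, 1]]: let [T] be the supremum of the times up to which [h] vanishes on the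
    segment. The zeros before [T] accumulate at [p + T * q], so [h] vanishes on a disc there, which
    forces [T = 1]. Concluding with a disc rather than a point lets segments be chained. *)
Lemma analytic_zero_along_segment (h : C -> C) (p q : C) : q <> RtoC 0 ->
  (forall t, 0 <= t <= 1 -> analytic_at h (p + RtoC t * q)%C) ->
  (exists d, 0 < d /\ forall s, Cmod (s - p) < d -> h s = RtoC 0) ->
  exists d, 0 < d /\ forall s, Cmod (s - (p + q)) < d -> h s = RtoC 0.
Proof.
  intros hq an (d0 & hd0 & near0). pose proof (proj1 (Cmod_gt_0 q) hq) as hm.
  set (E := fun t => 0 <= t <= 1 /\ forall u, 0 <= u <= t -> h (p + RtoC u * q)%C = RtoC 0).
  assert (dist : forall t u, Cmod (p + RtoC u * q - (p + RtoC t * q))%C = Rabs (u - t) * Cmod q).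
  { intros t u. rewrite <- Cmod_R, <- Cmod_mult. f_equal. rewrite RtoC_minus. ring. }
  assert (small : forall d, 0 < d -> 0 < d / (2 * Cmod q) /\ d / (2 * Cmod q) * Cmod q < d).
  { intros d hd. split; [apply Rdiv_lt_0_compat; lra|].
    replace (d / (2 * Cmod q) * Cmod q) with (d / 2) by (field; lra). lra. }
  assert (start : E (Rmin 1 (d0 / (2 * Cmod q)))).
  { destruct (small d0 hd0) as [s1 s2].
    pose proof (Rmin_l 1 (d0 / (2 * Cmod q))). pose proof (Rmin_r 1 (d0 / (2 * Cmod q))).
    assert (0 < Rmin 1 (d0 / (2 * Cmod q))) by (apply Rmin_pos; lra).
    split; [lra|]. intros u hu. apply near0.
    replace (p + RtoC u * q - p)%C with (RtoC u * q)%C by ring.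
    rewrite Cmod_mult, Cmod_R, Rabs_right by lra. nra. }
  destruct (completeness E) as [T [ub lub]].
  { exists 1. intros t [ht _]. lra. }
  { eexists; exact start. }
  assert (T0 : 0 < T).
  { eapply Rlt_le_trans; [|exact (ub _ start)]. destruct (small d0 hd0).
    apply Rmin_pos; lra. }
  assert (T1 : T <= 1) by (apply lub; intros t [ht _]; lra).
  assert (below : forall u, 0 <= u < T -> h (p + RtoC u * q)%C = RtoC 0).
  { intros u hu. apply NNPP. intros ne. apply (Rlt_not_le T u); [lra|]. apply lub.
    intros t [ht Ht]. apply Rnot_lt_le. intros lt. apply ne, Ht. lra. }
  destruct (analytic_at_isolated_zeros h _ (an T ltac:(lra))) as (d & hd & near).
  { intros d hd. destruct (small d hd) as [s1 s2].
    set (v := Rmin (T / 2) (d / (2 * Cmod q))).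
    assert (hv : 0 < v) by (apply Rmin_pos; lra).
    assert (v <= T / 2) by apply Rmin_l. assert (v <= d / (2 * Cmod q)) by apply Rmin_r.
    exists (p + RtoC (T - v) * q)%C. split; [|apply below; lra].
    rewrite dist. replace (T - v - T) with (- v) by ring.
    rewrite Rabs_Ropp, Rabs_right by lra. nra. }
  destruct (Rle_lt_or_eq_dec T 1 T1) as [lt|e].
  - exfalso. destruct (small d hd) as [s1 s2].
    set (t := Rmin 1 (T + d / (2 * Cmod q))).
    assert (t <= 1) by apply Rmin_l. assert (t <= T + d / (2 * Cmod q)) by apply Rmin_r.
    assert (T < t) by (apply Rmin_glb_lt; lra).
    apply (Rlt_not_le t T); [lra|]. apply ub. split; [lra|]. intros u hu.
    destruct (Rlt_le_dec u T) as [l|l]; [apply below; lra|].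
    apply near. rewrite dist, Rabs_right by lra. nra.
  - exists d. split; [exact hd|]. intros s hs. apply near.
    rewrite e. now replace (p + 1 * q)%C with (p + q)%C by ring.
Qed.

Lemma analytic_at_minus (f g : C -> C) (s0 : C) : analytic_at f s0 -> analytic_at g s0 ->
  analytic_at (fun s => f s - g s)%C s0.
Proof.
  intros (c & r & hr & hc) (d & r' & hr' & hd).
  exists (fun k => c k - d k)%C, (Rmin r r'). split; [now apply Rmin_pos|].
  intros s hs. pose proof (Rmin_l r r'). pose proof (Rmin_r r r').
  apply is_pseries_C_minus; [apply hc|apply hd]; lra.
Qed.

Lemma analytic_at_cpower_opp (a : R) (s0 : C) : analytic_at (fun s => cpower a (- s)%C) s0.
Proof.
  exists (power_coef a (- s0)), 1. split; [lra|]. intros s _.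
  replace (- s)%C with (- s0 - (s - s0))%C by ring. apply is_pseries_power_coef.
Qed.

(* The continuation is reached through the segments from [2 + al + i] to [al + i]
   and from there to [al], which avoid the pole at [1]. *)
Lemma hurwitz_continuation_step (a al : R) (f g : C -> C) :
  is_hurwitz_continuation a f -> is_hurwitz_continuation (a + 1) g ->
  0 < al -> al <> 1 -> (f (RtoC al) - g (RtoC al))%C = cpower a (- RtoC al)%C.
Proof.
  intros [sf af] [sg ag] h0 h1.
  set (h := fun s => (f s - g s - cpower a (- s))%C).
  assert (an : forall s, 0 < Re s -> s <> RtoC 1 -> analytic_at h s).
  { intros s hs hs1. apply analytic_at_minus; [apply analytic_at_minus; auto|].
    apply analytic_at_cpower_opp. }
  (* Here both functions are sums of series, and the series for [a + 1] is the one for [a] without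
     its first term. *)
  assert (right : forall s, 1 < Re s -> h s = RtoC 0).
  { intros s hs. specialize (sf s hs). specialize (sg s hs).
    assert (E : g s = (f s - cpower a (- s))%C).
    { apply (is_series_C_unique _ _ _ sg).
      apply (is_series_ext (fun n => cpower (a + INR (S n)) (- s))).
      - intros n. f_equal. rewrite S_INR. ring.
      - apply (is_series_incr_1 (V := C_NormedModule) (fun n => cpower (a + INR n) (- s))).
        replace (plus _ _) with (f s); [exact sf|]. simpl INR. rewrite Rplus_0_r.
        change (@eq C (f s) (f s - cpower a (- s) + cpower a (- s))%C). ring. }
    unfold h. rewrite E. ring. }
  assert (first : exists d, 0 < d /\
    forall s, Cmod (s - (((2 + al)%R, 1%R) + RtoC (-2)))%C < d -> h s = RtoC 0).
  { apply analytic_zero_along_segment.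
    - intros e. apply RtoC_inj in e. lra.
    - intros t ht. apply an.
      + unfold Cplus, Cmult, RtoC, Re; simpl. lra.
      + intros e. apply (f_equal Im) in e. unfold Cplus, Cmult, RtoC, Im in e; simpl in e. lra.
    - exists 1. split; [lra|]. intros s hs. apply right.
      pose proof (re_le_Cmod (s - ((2 + al)%R, 1%R))%C) as l.
      assert (l' : Rabs (Re (s - ((2 + al)%R, 1%R))%C) < 1) by lra. apply Rabs_def2 in l'.
      unfold Cminus, Cplus, Copp, Re in l'; simpl in l'. unfold Re. lra. }
  destruct (analytic_zero_along_segment h (al, 1) (0, -1)) as (d & hd & near).
  - intros e. apply (f_equal Im) in e. unfold RtoC, Im in e; simpl in e. lra.
  - intros t ht. apply an.
    + unfold Cplus, Cmult, RtoC, Re; simpl. lra.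
    + intros e. apply (f_equal Re) in e. unfold Cplus, Cmult, RtoC, Re in e; simpl in e.
      apply h1. lra.
  - replace (al, 1) with (((2 + al)%R, 1%R) + RtoC (-2))%C; [exact first|].
    unfold Cplus, RtoC; simpl. f_equal; ring.
  - specialize (near (RtoC al)).
    replace (RtoC al - ((al, 1%R) + (0%R, (-1)%R)))%C with (RtoC 0) in near by
      (unfold Cminus, Cplus, Copp, RtoC; simpl; f_equal; ring).
    rewrite Cmod_0 in near. specialize (near hd). unfold h in near.
    replace (f (RtoC al) - g (RtoC al))%C
      with (f al - g al - cpower a (- RtoC al) + cpower a (- RtoC al))%C by ring.
    rewrite near. ring.
Qed.

(** Existence alone makes [epsilon] return a continuation; [hurwitz_continuation_step] holds for
    whichever one it selects. *)
Lemma hurwitz_zeta_continuation (a : R) : 0 < a ->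
  is_hurwitz_continuation a (fun s => hurwitz_zeta s a).
Proof.
  intros ha. unfold hurwitz_zeta. apply epsilon_spec.
  eexists. exact (hurwitz_continuation_exists a ha).
Qed.

Lemma hurwitz_zeta_succ (a al : R) : 0 < a -> 0 < al -> al <> 1 ->
  (hurwitz_zeta (RtoC al) a - hurwitz_zeta (RtoC al) (a + 1))%C = RtoC (Rpower a (- al)).
Proof.
  intros ha h0 h1. rewrite <- cpower_R, RtoC_opp.
  exact (hurwitz_continuation_step a al _ _ (hurwitz_zeta_continuation a ha)
    (hurwitz_zeta_continuation (a + 1) ltac:(lra)) h0 h1).
Qed.

(** * Digit sums *)

Lemma sum_n_m_Sr (a : nat -> R) (n m : nat) : (n <= S m)%nat ->
  sum_n_m a n (S m) = sum_n_m a n m + a (S m).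
Proof. exact (sum_n_Sm a n m). Qed.

Lemma sum_n_m_linr (c : R) (u v : nat -> R) (n m : nat) :
  sum_n_m (fun k => u k + c * v k) n m = sum_n_m u n m + c * sum_n_m v n m.
Proof.
  transitivity (sum_n_m u n m + sum_n_m (fun k => c * v k) n m).
  - exact (sum_n_m_plus (G := R_AbelianMonoid) u (fun k => c * v k) n m).
  - f_equal. exact (sum_n_m_mult_l (K := R_Ring) c v n m).
Qed.

(** Abel summation: [n / m] jumps by one exactly when [n] is a multiple of [m], so only the values
    [f (k * m)] and the boundary term survive. *)
Lemma sum_quotients_by_parts (m : nat) (f : nat -> R) (N : nat) : (0 < m)%nat ->
  sum_n_m (fun n => INR (n / m) * (f n - f (S n))) 1 N
  = sum_n_m (fun k => f (k * m)%nat) 1 (N / m) - INR (N / m) * f (S N).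
Proof.
  intros hm. induction N as [|N IH].
  - rewrite Nat.Div0.div_0_l, !sum_n_m_zero by lia. unfold zero; simpl; rring.
  - rewrite sum_n_m_Sr by lia. rewrite IH.
    pose proof (Nat.div_mod_eq N m) as E.
    pose proof (Nat.mod_upper_bound N m ltac:(lia)) as B.
    destruct (Nat.eq_dec (S (N mod m)) m) as [e|e].
    + assert (H : (S N / m = S (N / m))%nat).
      { symmetry; apply Nat.div_unique with 0%nat; nia. }
      rewrite H, sum_n_m_Sr by lia.
      replace (S (N / m) * m)%nat with (S N) by nia.
      rewrite S_INR.  rring.
    + assert (H : (S N / m = N / m)%nat).
      { symmetry; apply Nat.div_unique with (S (N mod m)); nia. }
      rewrite H. rring.
Qed.

(** [digit_sum] reads a number of digits that depends on [n]; a common [K] is needed to exchange the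
    sums over digits and over [n]. *)
Definition digits_below (b K n : nat) : nat :=
  list_sum (map (fun i => ((n / b ^ i) mod b)%nat) (seq 0 K)).

Lemma digits_below_S (b K n : nat) :
  digits_below b (S K) n = (digits_below b K n + (n / b ^ K) mod b)%nat.
Proof.
  unfold digits_below. rewrite seq_S, map_app, list_sum_app. simpl. lia.
Qed.

Lemma digits_below_stable (b K j n : nat) : (2 <= b)%nat -> (n < b ^ K)%nat ->
  digits_below b (K + j) n = digits_below b K n.
Proof.
  intros hb hn. induction j as [|j IH].
  - now rewrite Nat.add_0_r.
  - rewrite Nat.add_succ_r, digits_below_S, IH, Nat.div_small.
    + rewrite Nat.Div0.mod_0_l; lia.
    + rewrite Nat.pow_add_r. pose proof (Nat.pow_nonzero b j). nia.
Qed.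

Lemma digit_sum_below (b p n : nat) : (2 <= b)%nat -> (n < b ^ p)%nat ->
  digit_sum b n = digits_below b p n.
Proof.
  intros hb hn. change (digit_sum b n) with (digits_below b (S n) n).
  rewrite <- (digits_below_stable b (S n) p) by
    (try assumption; pose proof (Nat.pow_gt_lin_r b (S n)); lia).
  now rewrite Nat.add_comm, digits_below_stable.
Qed.

(** The digit is [n / b ^ l - b * (n / b ^ S l)]. Both quotients are summed by parts, and their
    boundary terms cancel since [b ^ (p - l) = b * b ^ (p - S l)]. *)
Lemma sum_digit_by_parts (b p l : nat) (f : nat -> R) : (2 <= b)%nat -> (l < p)%nat ->
  sum_n_m (fun n => INR ((n / b ^ l) mod b) * (f n - f (S n))) 1 (b ^ p - 1)
  = sum_n_m (fun k => f (k * b ^ l)%nat) 1 (b ^ (p - l))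
    - INR b * sum_n_m (fun k => f (k * b ^ S l)%nat) 1 (b ^ (p - S l)).
Proof.
  intros hb hl.
  assert (quot : forall i, (i <= p)%nat ->
    sum_n_m (fun n => INR (n / b ^ i) * (f n - f (S n))) 1 (b ^ p - 1)
    = sum_n_m (fun k => f (k * b ^ i)%nat) 1 (b ^ (p - i))
      - INR (b ^ (p - i)) * f (b ^ p)%nat).
  { intros i hi.
    pose proof (Nat.pow_nonzero b i ltac:(lia)).
    pose proof (Nat.pow_nonzero b (p - i) ltac:(lia)).
    assert (E : (b ^ p = b ^ (p - i) * b ^ i)%nat).
    { rewrite <- Nat.pow_add_r. f_equal; lia. }
    rewrite sum_quotients_by_parts by lia.
    assert (D : ((b ^ p - 1) / b ^ i = b ^ (p - i) - 1)%nat).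
    { symmetry; apply Nat.div_unique with (b ^ i - 1)%nat; nia. }
    rewrite D. replace (S (b ^ p - 1)) with (b ^ p)%nat by nia.
    (* Summation by parts stops at [k = b ^ (p - i) - 1]. The missing index contributes [f (b ^ p)],
       which is paid for by raising the boundary coefficient by one. *)
    replace (b ^ (p - i))%nat with (S (b ^ (p - i) - 1)) at 3 4 by lia.
    rewrite sum_n_m_Sr by lia.
    replace (S (b ^ (p - i) - 1) * b ^ i)%nat with (b ^ p)%nat by nia.
    rewrite S_INR. rring. }
  rewrite (sum_n_m_ext _ (fun n => INR (n / b ^ l) * (f n - f (S n))
      + - INR b * (INR (n / b ^ S l) * (f n - f (S n))))).
  2:{ intros n.
      pose proof (Nat.div_mod_eq (n / b ^ l) b) as E.
      rewrite Nat.Div0.div_div, (Nat.mul_comm (b ^ l) b), <- Nat.pow_succ_r' in E.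
      apply (f_equal INR) in E. rewrite plus_INR, mult_INR in E.
      replace (INR ((n / b ^ l) mod b)) with (INR (n / b ^ l) - INR b * INR (n / b ^ S l)) by lra.
      rring. }
  rewrite sum_n_m_linr, !quot by lia.
  replace (p - l)%nat with (S (p - S l)) by lia.
  rewrite (Nat.pow_succ_r' b (p - S l)), mult_INR. rring.
Qed.

Lemma sum_digit_sum_by_parts (b p : nat) (f : nat -> R) : (2 <= b)%nat -> (1 <= p)%nat ->
  sum_n_m (fun n => INR (digit_sum b n) * (f n - f (S n))) 1 (b ^ p - 1)
  = sum_n_m (fun l => sum_n_m (fun k => f (k * b ^ l)%nat) 1 (b ^ (p - l))) 0 (p - 1)
    - INR b * sum_n_m (fun l => sum_n_m (fun k => f (k * b ^ l)%nat) 1 (b ^ (p - l))) 1 p.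
Proof.
  intros hb hp.
  assert (partial : forall K, (K < p)%nat ->
    sum_n_m (fun n => INR (digits_below b (S K) n) * (f n - f (S n))) 1 (b ^ p - 1)
    = sum_n_m (fun l => sum_n_m (fun k => f (k * b ^ l)%nat) 1 (b ^ (p - l))) 0 K
      - INR b * sum_n_m (fun l => sum_n_m (fun k => f (k * b ^ l)%nat) 1 (b ^ (p - l))) 1 (S K)).
  { induction K as [|K IH]; intros hK.
    - rewrite !sum_n_n, <- (sum_digit_by_parts b p 0 f) by lia.
      apply sum_n_m_ext. intros n. rewrite digits_below_S. reflexivity.
    - rewrite (sum_n_m_Sr _ 0 K), (sum_n_m_Sr _ 1 (S K)) by lia.
      rewrite (sum_n_m_ext _ (fun n => INR (digits_below b (S K) n) * (f n - f (S n))
        + 1 * (INR ((n / b ^ S K) mod b) * (f n - f (S n))))).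
      2:{ intros n. rewrite digits_below_S, plus_INR. rring. }
      rewrite sum_n_m_linr, IH, sum_digit_by_parts by lia.
      rring. }
  specialize (partial (p - 1)%nat ltac:(lia)).
  replace (S (p - 1)) with p in partial by lia.
  rewrite <- partial. apply sum_n_m_ext_loc. intros n hn.
  rewrite (digit_sum_below b p) by lia. reflexivity.
Qed.

(** * Telescoping differences and the two identities *)

Lemma hurwitz_zeta_diff (a al : R) (q : nat) : 0 <= a -> 0 < al -> al <> 1 ->
  (hurwitz_zeta (RtoC al) (1 + a) - hurwitz_zeta (RtoC al) (1 + (a + INR q)))%C
  = RtoC (sum_n_m (fun k => Rpower (a + INR k) (- al)) 1 q).
Proof.
  intros ha h0 h1. induction q as [|q IH].
  - rewrite sum_n_m_zero by lia. simpl INR. rewrite Rplus_0_r.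
    change (@zero _) with 0. ring.
  - rewrite sum_n_m_Sr, RtoC_plus, <- IH, <- hurwitz_zeta_succ
      by (try lia; try assumption; rewrite S_INR; pose proof (pos_INR q); lra).
    replace (a + INR (S q)) with (1 + (a + INR q)) by (rewrite S_INR; ring).
    replace (1 + (1 + (a + INR q))) with (1 + (a + INR q) + 1) by ring. ring.
Qed.

Lemma digamma_diff (a : R) (q : nat) : 0 <= a ->
  digamma (1 + (a + INR q)) - digamma (1 + a) = sum_n_m (fun k => 1 / (a + INR k)) 1 q.
Proof.
  intros ha. induction q as [|q IH].
  - rewrite sum_n_m_zero by lia. simpl INR. rewrite Rplus_0_r. apply Rminus_diag_eq, eq_refl.
  - rewrite sum_n_m_Sr, <- IH by lia. pose proof (pos_INR q).
    replace (1 + (a + INR (S q))) with (1 + (a + INR q) + 1) by (rewrite S_INR; ring).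
    rewrite digamma_succ by lra.
    replace (a + INR (S q)) with (1 + (a + INR q)) by (rewrite S_INR; ring). rring.
Qed.

Lemma sum_n_m_RtoC (u : nat -> R) (n m : nat) :
  sum_n_m (fun k => RtoC (u k)) n m = RtoC (sum_n_m u n m).
Proof.
  destruct (Nat.le_gt_cases n m) as [h|h]; [|now rewrite !sum_n_m_zero by lia].
  induction h as [|m h IH]; [now rewrite !sum_n_n|].
  rewrite sum_n_m_Sr by lia. etransitivity; [apply sum_n_Sm; lia|].
  rewrite IH, RtoC_plus. reflexivity.
Qed.

Lemma sum_n_m_scalr (c : R) (u : nat -> R) (n m : nat) :
  sum_n_m (fun k => c * u k) n m = c * sum_n_m u n m.
Proof. exact (sum_n_m_mult_l (K := R_Ring) c u n m). Qed.

(** The two arguments of [hurwitz_zeta] and of [digamma] thus differ by an integer, so the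
    telescoping differences apply. *)
Lemma shift_pow_split (b p l : nat) (z : R) : (2 <= b)%nat -> (l <= p)%nat ->
  (z + INR b ^ p) / INR b ^ l = z / INR b ^ l + INR (b ^ (p - l)).
Proof.
  intros hb hl. rewrite pow_INR.
  assert (h : INR b <> 0) by (apply not_0_INR; lia).
  replace (INR b ^ p) with (INR b ^ (p - l) * INR b ^ l) by
    (rewrite <- pow_add; f_equal; lia).
  field. now apply pow_nonzero.
Qed.

Lemma div_mult_cancel (c P S : R) : 0 < P -> c / P * (P * S) = c * S.
Proof. intros hP. field. lra. Qed.

Theorem theorem1 (b p : nat) (z : R)
    (hb : (2 <= b)%nat) (hp : (1 <= p)%nat) (hz : 0 <= z) :
  (forall alpha : R, 0 < alpha -> alpha <> 1 ->
     RtoC (sum_n_m (fun n : nat =>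
             INR (digit_sum b n) *
               (1 / Rpower (z + INR n) alpha - 1 / Rpower (z + INR n + 1) alpha))
             1 (b ^ p - 1))
     = (sum_n_m (fun l : nat =>
          RtoC (1 / Rpower (INR b) (alpha * INR l)) *
            (hurwitz_zeta (RtoC alpha) (1 + z / INR b ^ l)
             - hurwitz_zeta (RtoC alpha) (1 + (z + INR b ^ p) / INR b ^ l)))
          0 (p - 1)
        - sum_n_m (fun l : nat =>
            RtoC (INR b / Rpower (INR b) (alpha * INR l)) *
              (hurwitz_zeta (RtoC alpha) (1 + z / INR b ^ l)
               - hurwitz_zeta (RtoC alpha) (1 + (z + INR b ^ p) / INR b ^ l)))
            1 p)%C)
  /\
  sum_n_m (fun n : nat =>
      INR (digit_sum b n) / ((z + INR n) * (z + INR n + 1)))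
      1 (b ^ p - 1)
  = sum_n_m (fun l : nat =>
        1 / INR b ^ l *
          (digamma (1 + (z + INR b ^ p) / INR b ^ l)
           - digamma (1 + z / INR b ^ l)))
        0 (p - 1)
    - sum_n_m (fun l : nat =>
        INR b / INR b ^ l *
          (digamma (1 + (z + INR b ^ p) / INR b ^ l)
           - digamma (1 + z / INR b ^ l)))
        1 p.
Proof.
  assert (hb0 : 0 < INR b) by (apply lt_0_INR; lia).
  assert (hbl : forall l, 0 < INR b ^ l) by (intros l; now apply pow_lt).
  assert (hzl : forall l, 0 <= z / INR b ^ l).
  { intros l. apply Rmult_le_pos; [exact hz|left; now apply Rinv_0_lt_compat]. }
  assert (scaled : forall l k, z / INR b ^ l + INR k = (z + INR (k * b ^ l)) / INR b ^ l).
  { intros l k. rewrite mult_INR, pow_INR. field. apply Rgt_not_eq, hbl. }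
  (* Summation from [n = 1] keeps bases and denominators positive when [z = 0]. *)
  assert (zn_pos : forall n, (1 <= n)%nat -> 0 < z + INR n).
  { intros n hn. apply le_INR in hn. simpl in hn. lra. }
  split.
  - intros al h0 h1. set (f := fun n => 1 / Rpower (z + INR n) al).
    assert (inner : forall l, (l <= p)%nat ->
      (hurwitz_zeta (RtoC al) (1 + z / INR b ^ l)
        - hurwitz_zeta (RtoC al) (1 + (z + INR b ^ p) / INR b ^ l))%C
      = RtoC (Rpower (INR b) (al * INR l)
          * sum_n_m (fun k => f (k * b ^ l)%nat) 1 (b ^ (p - l)))).
    { intros l hl. rewrite (shift_pow_split b p l z hb hl), hurwitz_zeta_diff by auto.
      f_equal. rewrite <- sum_n_m_scalr. apply sum_n_m_ext_loc. intros k hk.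
      pose proof (Nat.pow_nonzero b l ltac:(lia)).
      pose proof (zn_pos (k * b ^ l)%nat ltac:(nia)) as pos.
      unfold f. rewrite scaled, Rpower_Ropp.
      rewrite <- (Rpower_pow l (INR b) hb0).
      (* Homogeneity of the power: scaling by [b ^ l] produces the factor that the weights
         [b ^ (- al * l)] of the theorem cancel. *)
      assert (E : Rpower (z + INR (k * b ^ l)) al
        = Rpower ((z + INR (k * b ^ l)) / Rpower (INR b) (INR l)) al
          * Rpower (INR b) (al * INR l)).
      { rewrite (Rmult_comm al), <- Rpower_mult, Rpower_mult_distr.
        - f_equal. field. apply Rgt_not_eq, Rpower_pos.
        - apply Rdiv_lt_0_compat; [exact pos|apply Rpower_pos].
        - apply Rpower_pos. }
      rewrite E. rfield. split; apply Rgt_not_eq, Rpower_pos. }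
    rewrite (sum_n_m_ext _ (fun n => INR (digit_sum b n) * (f n - f (S n)))).
    2:{ intros n. unfold f. now rewrite S_INR, Rplus_assoc. }
    rewrite (sum_digit_sum_by_parts b p f hb hp), RtoC_minus.
    rewrite <- sum_n_m_scalr, <- !sum_n_m_RtoC. f_equal.
    + apply sum_n_m_ext_loc. intros l hl. rewrite inner by lia.
      rewrite <- RtoC_mult, div_mult_cancel by apply Rpower_pos. now rewrite ?Rmult_1_l.
    + apply sum_n_m_ext_loc. intros l hl. rewrite inner by lia.
      rewrite <- RtoC_mult, div_mult_cancel by apply Rpower_pos. now rewrite ?Rmult_1_l.
  - set (f := fun n => 1 / (z + INR n)).
    assert (inner : forall l, (l <= p)%nat ->
      digamma (1 + (z + INR b ^ p) / INR b ^ l) - digamma (1 + z / INR b ^ l)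
      = INR b ^ l * sum_n_m (fun k => f (k * b ^ l)%nat) 1 (b ^ (p - l))).
    { intros l hl. rewrite (shift_pow_split b p l z hb hl), digamma_diff by auto.
      rewrite <- sum_n_m_scalr. apply sum_n_m_ext_loc. intros k hk.
      pose proof (Nat.pow_nonzero b l ltac:(lia)).
      pose proof (zn_pos (k * b ^ l)%nat ltac:(nia)) as pos.
      unfold f. rewrite scaled. specialize (hbl l). rfield. lra. }
    (* Partial fractions, valid on the range of summation, where [z + n] is nonzero. *)
    rewrite (sum_n_m_ext_loc _ (fun n => INR (digit_sum b n) * (f n - f (S n)))).
    2:{ intros n hn. unfold f. rewrite S_INR. pose proof (zn_pos n ltac:(lia)).
        rfield. lra. }
    rewrite (sum_digit_sum_by_parts b p f hb hp), <- sum_n_m_scalr. f_equal.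
    + apply sum_n_m_ext_loc. intros l hl. rewrite inner by lia. rewrite div_mult_cancel by auto.
      now rewrite ?Rmult_1_l.
    + apply sum_n_m_ext_loc. intros l hl. rewrite inner by lia. rewrite div_mult_cancel by auto.
      now rewrite ?Rmult_1_l.
Qed.
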